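(* Let $d,K\ge 2$ be integers and let $\boldsymbol{S}=\{S_1,\ldots,S_K\}\subset\mathbb{C}^{d\times d}$ be an arbitrary finite family of matrices. Then the following two statements are equivalent. (1) $\boldsymbol{S}$ has the spectral finiteness property, i.e., there are an integer $n\ge 1$ and a word $(i_1^*,\dotsc,i_n^* )\in\{1,\dotsc,K\}^n$ such that $$\rho(\boldsymbol{S})=\sqrt[n]{\rho(S_{i_1^*}\cdots S_{i_n^*})}.$$ (2) There is an extremal $\theta$-ergodic probability measure $\mu_*$ for $\boldsymbol{S}$ on $\varSigma_K^+$ which has a periodic density point $\xi_{\cdot}\in\varSigma_K^+$.
   Context: Let $\mathbb{N}=\{1,2,\dotsc\}$. $\varSigma_K^+$ denotes the compact space of all one-sided infinite sequences $i_{\cdot}=(i_n)_{n\ge1}\colon\mathbb{N}\to\{1,\dotsc,K\}$ with the product topology ($\{1,\dots,K\}$ discrete), equipped with its Borel $\sigma$-field, and $\theta\colon\varSigma_K^+\to\varSigma_K^+$, $\theta\big((i_n)_{n\ge1}\big)=(i_{n+1})_{n\ge1}$, is the one-sided shift. A $\theta$-ergodic probability measure is a $\theta$-invariant Borel probability measure on $\varSigma_K^+$ that is ergodic for $\theta$. For a single matrix $A\in\mathbb{C}^{d\times d}$, $\rho(A)$ is the usual spectral radius. For the family $\boldsymbol{S}$, the generalized spectral radius is $$\rho(\boldsymbol{S})=\limsup_{n\to+\infty}\max_{i_{\cdot}\in\varSigma_K^+}\sqrt[n]{\rho(S_{i_1}\cdots S_{i_n})}\quad\Big(=\sup_{n\ge1}\max_{i_{\cdot}\in\varSigma_K^+}\sqrt[n]{\rho(S_{i_1}\cdots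 S_{i_n})}\Big),$$ which by the Berger–Wang formula equals the joint spectral radius $\hat\rho(\boldsymbol{S})=\limsup_{n\to+\infty}\max_{i_{\cdot}\in\varSigma_K^+}\sqrt[n]{\|S_{i_1}\cdots S_{i_n}\|}$, where $\|\cdot\|$ is any submultiplicative matrix norm. A $\theta$-ergodic probability measure $\mu_*$ is called extremal for $\boldsymbol{S}$ if $\rho(\boldsymbol{S})=\lim_{n\to+\infty}\sqrt[n]{\|S_{i_1}\cdots S_{i_n}\|}$ for $\mu_*$-a.e. $i_{\cdot}\in\varSigma_K^+$. A point $i_{\cdot}\in\varSigma_K^+$ is a density point of a Borel probability measure $\mu$ if $\mu(U)>0$ for every open neighborhood $U$ of $i_{\cdot}$. A sequence $i_{\cdot}\in\varSigma_K^+$ is periodic if there is an integer $\pi\ge1$ with $i_{n+\pi}=i_n$ for all $n\in\mathbb{N}$. *)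

(* Defs.v *)
From HB Require Import structures.
From mathcomp Require Import all_boot all_order all_algebra.
From mathcomp Require Import all_classical all_reals all_analysis.
From mathcomp Require Import complex.
Import Order.TTheory GRing.Theory Num.Theory.
Import numFieldNormedType.Exports.

Set Implicit Arguments.
Unset Strict Implicit.
Unset Printing Implicit Defensive.

Local Open Scope classical_set_scope.
Local Open Scope ring_scope.

(* The letters 1, ..., K are represented by the elements 0, ..., K.-1 of 'I_K,
   and the terms i_1, i_2, ... of a sequence i by i 0, i 1, ... *)
Definition shift_space (K : nat) : Type :=
  prod_topology (fun _ : nat => discrete_topology 'I_K).
HB.instance Definition _ (K : nat) := Topological.on (shift_space K).

(* Measurable types are pointed, whence the alphabets 'I_K.+1 below. *)
HB.instance Definition _ (K : nat) :=
  isPointed.Build (shift_space K.+1) (fun _ => ord0).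

Definition borel_shift_space (K : nat) : Type :=
  g_sigma_algebraType (@open (shift_space K)).
HB.instance Definition _ (K : nat) := Measurable.on (borel_shift_space K.+1).

Definition left_shift (K : nat) (i : shift_space K) : shift_space K :=
  fun n => i n.+1.

Definition periodic_seq (K : nat) (i : shift_space K) : Prop :=
  exists2 p : nat, (1 <= p)%N & forall n : nat, i (n + p)%N = i n.

Definition ergodic (R : realType) (K : nat)
    (mu : probability (borel_shift_space K.+1) R) : Prop :=
  (forall A : set (borel_shift_space K.+1), measurable A ->
     mu (@left_shift K.+1 @^-1` A) = mu A) /\
  (forall A : set (borel_shift_space K.+1), measurable A ->
     @left_shift K.+1 @^-1` A = A -> mu A = 0%E \/ mu A = 1%E).

Definition density_point (R : realType) (K : nat)
    (mu : probability (borel_shift_space K.+1) R) (x : shift_space K.+1) :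
    Prop :=
  forall U : set (shift_space K.+1), open U -> U x -> (0 < mu U)%E.

Definition submultiplicative_norm (R : realType) (d : nat)
    (N : 'M[R[i]]_d -> R) : Prop :=
  [/\ forall A, N A = 0 -> A = 0,
      forall (a : R[i]) A, N (a *: A) = Normc.normc a * N A,
      forall A B, N (A + B) <= N A + N B &
      forall A B, N (A *m B) <= N A * N B].

Definition spectral_radius (R : realType) (d : nat) (A : 'M[R[i]]_d) : R :=
  sup [set Normc.normc a | a in [set a : R[i] | eigenvalue A a]].

(* The product S_{i_1} ... S_{i_n} depends only on the first n terms of i, so
   the maximum over all sequences i is taken over the words of length n. The
   maximum has nonnegative arguments, hence the neutral value 0; the index
   n = 0 does not affect the limit superior. *)
Definition gen_spectral_radius (R : realType) (d K : nat)
    (S : 'I_K -> 'M[R[i]]_d) : R :=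
  limn_sup (fun n : nat => \big[Num.max/0]_(w : n.-tuple 'I_K)
    (spectral_radius (\prod_(k < n) S (tnth w k)) `^ n%:R^-1)).

Definition spectral_finiteness (R : realType) (d K : nat)
    (S : 'I_K -> 'M[R[i]]_d) : Prop :=
  exists n : nat, exists w : n.-tuple 'I_K, (1 <= n)%N /\
    gen_spectral_radius S =
      spectral_radius (\prod_(k < n) S (tnth w k)) `^ n%:R^-1.

Definition extremal (R : realType) (d K : nat) (N : 'M[R[i]]_d -> R)
    (S : 'I_K.+1 -> 'M[R[i]]_d)
    (mu : probability (borel_shift_space K.+1) R) : Prop :=
  {ae mu, forall i : shift_space K.+1,
    (fun n : nat => N (\prod_(k < n) S (i k)) `^ n%:R^-1) @ \oo
      --> gen_spectral_radius S}.

(* Main.v *)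
From HB Require Import structures.
Require Import Defs.
From mathcomp Require Import all_boot all_order all_algebra.
From mathcomp Require Import all_classical all_reals all_analysis.
From mathcomp Require Import measurable_realfun complex spectral ring lra.
Import Order.TTheory GRing.Theory Num.Theory.
Import numFieldNormedType.Exports.

Set Implicit Arguments.
Unset Strict Implicit.
Unset Printing Implicit Defensive.

Local Open Scope classical_set_scope.
Local Open Scope ring_scope.

(** (1) => (2): if the word [w] attains the generalized spectral radius, the
    uniform measure on the orbit of [w w w ...] is ergodic, and Gelfand's formula
    makes it extremal.

    (2) => (1): suppose that the finiteness property fails, let [w0] be a period of
    the periodic density point, and normalize the generalized spectral radius to
    1. All products have spectral radius at most 1 and [w0] has spectral radius
    less than 1.  For large [q] and every [eps > 0] there is a norm for which all
    the letters have norm at most [1 + eps] and the word [w0^q] has norm at most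
    [1/2 + eps].  The cylinder of [w0^q] has positive measure [delta], so that by
    invariance alone, with probability at least [delta/2], the first [n] blocks
    of length [|w0^q|] contain at least [n delta/2] copies of [w0^q], and then
    the product decays exponentially.  By the reverse Fatou lemma this happens
    infinitely often on a set of positive measure, against extremality.

    The norm is built by induction on the dimension.  If the trace form of the
    algebra spanned by the products is nondegenerate, then the products are
    bounded, since their traces are, and the supremum of the norms of [v P]
    over all products [P] is such a norm.  Otherwise the radical of the trace form
    yields an invariant subspace, and one combines norms on the subspace and on
    the quotient. *)

(** * Eigenvalues and traces *)

Lemma trig_mulmx (R : pzRingType) (n : nat) (A B : 'M[R]_n) :
  is_trig_mx A -> is_trig_mx B ->
  is_trig_mx (A *m B) /\ forall i, (A *m B) i i = A i i * B i i.
Proof.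
move=> /is_trig_mxP tA /is_trig_mxP tB; split=> [|i].
  apply/is_trig_mxP => i j ltij; rewrite mxE big1// => k _.
  have [ltik|leki] := ltnP i k; first by rewrite tA ?mul0r.
  by rewrite tB ?mulr0 ?(leq_ltn_trans leki).
rewrite mxE (bigD1 i)//= big1 ?addr0// => k neki.
have [ltik|leki] := ltnP i k; first by rewrite tA ?mul0r.
by rewrite tB ?mulr0// ltn_neqAle leki neki.
Qed.

Lemma trig_expmx (R : nzRingType) (n : nat) (A : 'M[R]_n) (k : nat) :
  is_trig_mx A ->
  is_trig_mx (A ^+ k) /\ forall i, (A ^+ k) i i = A i i ^+ k.
Proof.
move=> tA; elim: k => [|k [tAk IHk]].
  by split=> [|i]; rewrite ?scalar_mx_is_trig// expr0 mxE eqxx.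
by rewrite exprS; have [? E] := trig_mulmx tA tAk; split=> // i; rewrite E IHk exprS.
Qed.

(** Schur triangularization: [A] is similar to a triangular matrix whose diagonal [D] lists the
    eigenvalues with multiplicity, and the powers of that matrix carry the powers of [D] on the
    diagonal. *)
Lemma mxtrace_exp_eigenvalues (C : numClosedFieldType) (n : nat) (A : 'M[C]_n) :
  exists2 D : 'I_n -> C, char_poly A = \prod_i ('X - (D i)%:P) &
    forall k, \tr (A ^+ k) = \sum_i D i ^+ k.
Proof.
case: n A => [|n] A.
  exists (fun=> 0) => [|k]; last by rewrite /mxtrace !big_ord0.
  by rewrite /char_poly det_mx00 big_ord0.
have [P /unitarymx_unit uP trPA] := Schur A isT.
have {trPA} trT : is_trig_mx (P *m A *m invmx P) by rewrite -conjumx.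
have TX k : (P *m A *m invmx P) ^+ k = P *m A ^+ k *m invmx P.
  elim: k => [|k IHk]; first by rewrite !expr0 mulmx1 mulmxV.
  by rewrite !exprS IHk -!mulmxE !mulmxA mulmxKV.
exists (fun i => (P *m A *m invmx P) i i) => [|k].
  rewrite -(char_poly_trig trT) /char_poly /char_poly_mx.
  have uP' : map_mx polyC P \in unitmx by rewrite map_unitmx.
  have -> : 'X%:M - map_mx polyC (P *m A *m invmx P) =
    map_mx polyC P *m ('X%:M - map_mx polyC A) *m invmx (map_mx polyC P).
    rewrite mulmxBr mulmxBl scalar_mxC mulmxK//.
    by rewrite !map_mxM map_invmx.
  by rewrite !det_mulmx mulrAC -det_mulmx mulmxV// det1 mul1r.
rewrite -(eq_bigr _ (fun i _ => (trig_expmx k trT).2 i)) -/(mxtrace _) TX.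
by rewrite mxtrace_mulC mulmxA mulVmx// mul1mx.
Qed.

Lemma eigenvaluesP (C : numClosedFieldType) (d : nat) (A : 'M[C]_d) :
  exists D : 'I_d -> C, forall a, eigenvalue A a <-> exists i, a = D i.
Proof.
have [D chA _] := mxtrace_exp_eigenvalues A; exists D => a.
rewrite eigenvalue_root_char chA /root horner_prod; split.
  by move=> /prodf_eq0[i _]; rewrite hornerXsubC subr_eq0 => /eqP; exists i.
by case=> i ->; apply/prodf_eq0; exists i; rewrite // hornerXsubC subrr.
Qed.

Lemma norm_mxtrace_le (C : numClosedFieldType) (n : nat) (A : 'M[C]_n) :
  (forall a, eigenvalue A a -> `|a| <= 1) -> `|\tr A| <= n%:R.
Proof.
move=> eigA; have [D chA /(_ 1)] := mxtrace_exp_eigenvalues A.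
rewrite expr1 => ->; apply: le_trans (ler_norm_sum _ _ _) _.
rewrite -[n in n%:R]card_ord -sum1_card natr_sum ler_sum// => i _.
rewrite expr1; apply: eigA.
rewrite eigenvalue_root_char chA /root horner_prod.
by apply/prodf_eq0; exists i; rewrite // hornerXsubC subrr.
Qed.

(** A nonzero fixed vector makes 1 an eigenvalue. Summing over the spectrum a polynomial that
    isolates the eigenvalue 1 then shows that its multiplicity is zero, since all the power sums
    vanish. *)
Lemma mxtrace_exp0_fixed (C : numClosedFieldType) (n : nat) (A : 'M[C]_n)
    (v : 'rV[C]_n) :
  (forall k, (0 < k)%N -> \tr (A ^+ k) = 0) -> v *m A = v -> v = 0.
Proof.
move=> trA0 vA; apply/eqP; apply: contraT => v_neq0.
have [D chA trA] := mxtrace_exp_eigenvalues A.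
have [i0 Di0] : exists i, D i = 1.
  have : eigenvalue A 1 by apply/eigenvalueP; exists v; rewrite ?scale1r.
  rewrite eigenvalue_root_char chA /root horner_prod => /prodf_eq0[i _].
  by rewrite hornerXsubC subr_eq0 => /eqP; exists i.
(* The factor ['X] removes the constant coefficient: the trace of [A ^+ 0] is not assumed to
   vanish. *)
pose p : {poly C} := 'X * \prod_(i | D i != 1) ('X - (D i)%:P).
have p0 : \sum_i p.[D i] = 0.
  under eq_bigr do rewrite horner_coef.
  rewrite exchange_big big1//= => k _; rewrite -mulr_sumr -trA.
  have [k0|/trA0 ->] := posnP k; last by rewrite mulr0.
  by rewrite k0 coefXM mul0r.
have p1 : p.[1] != 0.
  rewrite hornerM hornerX mul1r horner_prod; apply/prodf_neq0 => i Di.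
  by rewrite hornerXsubC subr_eq0 eq_sym.
have : \sum_i p.[D i] = \sum_(i | D i == 1) p.[1].
  rewrite (bigID (fun i => D i == 1))/= [X in _ + X]big1 ?addr0.
    by apply: eq_bigr => i /eqP ->.
  move=> i Di; rewrite hornerM horner_prod (bigD1 i)//= hornerXsubC subrr.
  by rewrite mul0r mulr0.
rewrite p0 sumr_const => /esym/eqP; rewrite mulrn_eq0 (negPf p1) orbF.
by move=> /eqP/card0_eq/(_ i0)/idP[]; apply/eqP.
Qed.

Lemma word_span_basis (F : fieldType) (d : nat) (I : Type) (S : I -> 'M[F]_d) :
  exists (k : nat) (y : 'I_k -> seq I),
    let Y := [tuple \prod_(i <- y j) S i | j < k] in
    free Y /\ forall w, \prod_(i <- w) S i \in <<Y>>%VS.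
Proof.
pose P w := \prod_(i <- w) S i.
suff [ws fY spanY] : exists2 ws, free (map P ws) & forall w, P w \in <<map P ws>>%VS.
  exists (size ws), (tnth (in_tuple ws)) => /=.
  have -> : [seq \prod_(i <- tnth (in_tuple ws) j) S i | j <- enum 'I_(size ws)]
    = map P ws.
    rewrite (map_comp P (tnth (in_tuple ws))); congr map.
    by rewrite map_tnth_enum.
  by [].
(* Greedy extension: a word whose product lies outside the span keeps the family free, so the number
   of words is bounded by the dimension of the matrix space. *)
have ext n : forall ws, free (map P ws) ->
    (\dim {:'M[F]_d} - size ws < n)%N ->
    exists2 ws, free (map P ws) & forall w, P w \in <<map P ws>>%VS.
  elim: n => // n IHn ws fws ltn.
  have [|/existsNP[w /negP Pw]] := pselect (forall w, P w \in <<map P ws>>%VS).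
    by exists ws.
  have fws' : free (map P (w :: ws)) by rewrite free_cons Pw.
  apply: (IHn (w :: ws)) => //.
  have := eqP fws'; rewrite size_map => dimE.
  have := dimvS (subvf <<map P (w :: ws)>>%VS); rewrite dimE /= => le.
  by rewrite -ltnS; apply: leq_trans ltn; rewrite ltnS ltn_sub2l.
by apply: (ext (\dim {:'M[F]_d} - 0).+1 [::]); rewrite //= nil_free.
Qed.

(* If the trace form on the algebra spanned by the products of [S] is
   nondegenerate, it gives the coordinates of every product; otherwise its
   radical is a nil ideal, which kills the invariant subspace generated by a
   suitable vector. *)
Lemma invariant_subspace_or_trace_coordinates (C : numClosedFieldType) (d : nat)
    (I : Type) (S : I -> 'M[C]_d) :
  (exists (k : nat) (U : 'M[C]_(k, d)),
     (0 < \rank U < d)%N /\ forall i, (U *m S i <= U)%MS) \/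
  (exists (k : nat) (y : 'I_k -> seq I) (G : 'M[C]_k), forall w,
     \prod_(i <- w) S i =
     \sum_j (\sum_l \tr (\prod_(i <- w ++ y l) S i) * G l j)
               *: \prod_(i <- y j) S i).
Proof.
have [k [y [fY spanY]]] := word_span_basis S.
pose P w : 'M[C]_d := \prod_(i <- w) S i; pose Y := [tuple P (y j) | j < k].
have YE (j : 'I_k) : Y`_j = P (y j) by rewrite -tnth_nth tnth_mktuple.
have PM w1 w2 : P w1 *m P w2 = P (w1 ++ w2) by rewrite /P big_cat.
(* Gram matrix of the trace form in the basis [Y]. If [c] is the row of coordinates of [P w], then
   [c *m Gr] lists the traces of the [P (w ++ y l)], so an invertible [Gr] recovers [c] from
   them. *)
pose Gr := \matrix_(j, l) \tr (P (y j) *m P (y l)).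
have [uG|sG] := boolP (Gr \in unitmx); [right | left].
  exists k, y, (invmx Gr) => w; rewrite -/(P w).
  have Pw := coord_span (spanY w); rewrite -/(P w) -/Y in Pw.
  pose c : 'rV_k := \row_j coord Y j (P w).
  have tE : c *m Gr = \row_l \tr (P (w ++ y l)).
    apply/rowP => l; rewrite mxE [RHS]mxE -PM Pw mulmx_suml raddf_sum/=.
    by apply: eq_bigr => j _; rewrite !mxE -scalemxAl mxtraceZ YE.
  rewrite {1}Pw; apply: eq_bigr => j _; rewrite YE -/(P (y j)); congr (_ *: _).
  have := congr1 (fun M => (M *m invmx Gr) 0 j) tE.
  by rewrite /= mulmxK// !mxE => ->; apply: eq_bigr => l _; rewrite mxE.
have A1 : 1%:M \in <<Y>>%VS by have := spanY [::]; rewrite big_nil.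
have AM Z1 Z2 : Z1 \in <<Y>>%VS -> Z2 \in <<Y>>%VS -> Z1 *m Z2 \in <<Y>>%VS.
  move=> /coord_span -> /coord_span ->; rewrite mulmx_suml memv_suml// => i _.
  rewrite mulmx_sumr memv_suml// => j _.
  by rewrite -scalemxAl -scalemxAr !memvZ// !YE PM spanY.
(* The radical of the trace form inside the algebra spanned by [Y]; [JMr] and [JMl] show that it is
   a two-sided ideal. *)
pose J := (<<Y>> :&: \bigcap_(l < k)
  lker (linfun (mxtrace \o mulmxr (P (y l)) : 'M[C]_d -> C^o)))%VS.
have JP X : X \in J <-> X \in <<Y>>%VS /\ forall l, \tr (X *m P (y l)) = 0.
  rewrite memv_cap; split=> [/andP[XY /subv_bigcapP XJ]|[XY XJ]].
    split=> // l; have := XJ l isT.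
    by rewrite -memvE memv_ker lfunE/= => /eqP.
  rewrite XY; apply/subv_bigcapP => l _; rewrite -memvE memv_ker lfunE/=.
  by rewrite XJ.
have trJ X Z : X \in J -> Z \in <<Y>>%VS -> \tr (X *m Z) = 0.
  move=> /JP[_ XJ] /coord_span ->; rewrite mulmx_sumr raddf_sum/= big1// => l _.
  by rewrite -scalemxAr mxtraceZ YE XJ mulr0.
have JMr X Z : X \in J -> Z \in <<Y>>%VS -> X *m Z \in J.
  move=> XJ ZY; apply/JP; split=> [|l]; first by apply: AM => //; case/JP: XJ.
  by rewrite -mulmxA trJ// AM// -YE memv_span// mem_nth// size_tuple.
have JMl X Z : X \in J -> Z \in <<Y>>%VS -> Z *m X \in J.
  move=> XJ ZY; apply/JP; split=> [|l]; first by apply: AM => //; case/JP: XJ.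
  rewrite -mulmxA mxtrace_mulC -mulmxA trJ// AM//.
  by rewrite -YE memv_span// mem_nth// size_tuple.
(* All positive powers of an element of the radical have trace zero. *)
have Jnil X (v : 'rV_d) : X \in J -> v *m X = v -> v = 0.
  move=> XJ; apply: mxtrace_exp0_fixed => -[//|m] _.
  rewrite exprS -mulmxE trJ//; elim: m => [|m IHm]; first by rewrite expr0.
  by rewrite exprS -mulmxE AM//; case/JP: XJ.
(* A row vector in the kernel of the singular Gram matrix gives the coordinates of [X0]. *)
have [X0 X0_neq0 X0J] : exists2 X, X != 0 & X \in J.
  have /rowV0Pn[c] : kermx Gr != 0.
    apply: contraNneq sG => ker0; rewrite -row_free_unit.
    by rewrite -kermx_eq0 ker0.
  move=> /sub_kermxP cG c_neq0; exists (\sum_j c 0 j *: Y`_j).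
    apply: contra_neq c_neq0 => sum0; apply/rowP => j; rewrite mxE.
    by have /freeP/(_ (fun j => c 0 j) sum0 j) := fY.
  apply/JP; split=> [|l].
    rewrite memv_suml// => j _; rewrite memvZ// memv_span// mem_nth//.
    by rewrite size_tuple.
  have := congr1 (fun M : 'rV_k => M 0 l) cG; rewrite !mxE => cGl; rewrite -[RHS]cGl.
  rewrite mulmx_suml raddf_sum/=; apply: eq_bigr => j _.
  by rewrite -scalemxAl mxtraceZ YE mxE.
have [u u_neq0 uJ] : exists2 u : 'rV_d, u != 0 & forall X, X \in J -> u *m X = 0.
  (* If [v *m X] is nonzero, it replaces [v]. The image of [J] shrinks strictly: otherwise [v *m X]
     would equal [v *m X *m Z] with [Z] in [J], against [Jnil]. *)
  have descent n : forall v : 'rV_d, v != 0 ->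
      (\dim (linfun (mulmx v) @: J)%VS < n)%N ->
      exists2 u : 'rV_d, u != 0 & forall X, X \in J -> u *m X = 0.
    elim: n => // n IHn v v_neq0 ltn.
    have [|/existsNP[X /not_implyP[XJ /eqP vX]]] :=
      pselect (forall X, X \in J -> v *m X = 0); first by exists v.
    apply: (IHn (v *m X)) => //; rewrite -ltnS; apply: leq_trans ltn; rewrite ltnS.
    have le : (linfun (mulmx (v *m X)) @: J <= linfun (mulmx v) @: J)%VS.
      apply/subvP => _ /memv_imgP[Z ZJ ->]; apply/memv_imgP.
      exists (X *m Z); first by apply: JMr => //; case/JP: ZJ.
      by rewrite !lfunE/= mulmxA.
    rewrite ltn_neqAle dimvS// andbT (dimv_leqif_sup le).
    apply/negP => /subvP/(_ (v *m X)) H.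
    have /H/memv_imgP[Z ZJ] : v *m X \in (linfun (mulmx v) @: J)%VS.
      by apply/memv_imgP; exists X; rewrite ?lfunE.
    by rewrite lfunE/= => /esym/(Jnil _ _ ZJ)/eqP; rewrite (negPf vX).
  have d_gt0 : (0 < d)%N.
    rewrite lt0n; apply: contra_neqN X0_neq0 => /eqP d0; apply/matrixP => -[m +].
    by move=> lt_m; exfalso; move: lt_m; rewrite d0.
  pose i0 := Ordinal d_gt0.
  apply: (descent _ (delta_mx 0 i0)) (ltnSn _).
  apply/eqP => /rowP/(_ i0); rewrite !mxE !eqxx => /eqP.
  by rewrite oner_eq0.
(* The rows span the orbit of [u] under the algebra. This space contains [u], and it is proper
   because [X0] kills it: [J] is a left ideal and [u] is killed by [J]. *)
pose U := \matrix_(j < k) (u *m P (y j)).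
have UY Z : Z \in <<Y>>%VS -> (u *m Z <= U)%MS.
  move=> /coord_span ->; rewrite mulmx_sumr summx_sub// => j _.
  rewrite -scalemxAr scalemx_sub// YE.
  by rewrite (_ : u *m P (y j) = row j U) ?row_sub// rowK.
exists k, U; split=> [|i].
  apply/andP; split.
    rewrite lt0n mxrank_eq0; apply: contra_neq u_neq0 => U0.
    by have := UY _ A1; rewrite mulmx1 => /submxP[D ->]; rewrite U0 mulmx0.
  rewrite ltn_neqAle rank_leq_col andbT; apply: contra_neqN X0_neq0 => fU.
  rewrite -[X0]mul1mx -(mulVpmx fU) -mulmxA.
  rewrite (_ : U *m X0 = 0) ?mulmx0//; apply/row_matrixP => j.
  rewrite row_mul rowK row0 -mulmxA uJ// JMl// -YE memv_span// mem_nth//.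
  by rewrite size_tuple.
apply/row_subP => j; rewrite row_mul rowK -mulmxA UY//.
by have := spanY (rcons (y j) i); rewrite big_rcons/=.
Qed.

(** * Seminorms and powers of a matrix *)

Definition seminorm (R : realType) (V : lmodType R[i]) (p : V -> R) : Prop :=
  (forall a v, p (a *: v) = Normc.normc a * p v) /\
  (forall u v, p (u + v) <= p u + p v).

Lemma normc_ge0 (R : realType) (a : R[i]) : 0 <= Normc.normc a.
Proof. by case: a => x y; apply: sqrtr_ge0. Qed.

Lemma normcD_le (R : realType) (a b : R[i]) :
  Normc.normc (a + b) <= Normc.normc a + Normc.normc b.
Proof. by rewrite -lecR rmorphD/=; exact: (@ler_normD _ R[i]). Qed.

Lemma normc_sum_le (R : realType) (I : Type) (s : seq I) (P : pred I) (f : I -> R[i]) :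
  Normc.normc (\sum_(i <- s | P i) f i) <= \sum_(i <- s | P i) Normc.normc (f i).
Proof.
elim/big_ind2: _ => [|a x b y lex ley|//]; first by rewrite Normc.normc0.
exact: le_trans (normcD_le x y) (lerD lex ley).
Qed.

Lemma normcX (R : realType) (a : R[i]) (n : nat) :
  Normc.normc (a ^+ n) = Normc.normc a ^+ n.
Proof.
by elim: n => [|n IHn]; rewrite ?Normc.normc1// !exprS Normc.normcM IHn.
Qed.

Section Seminorm.
Context (R : realType) (V : lmodType R[i]) (p : V -> R) (hp : seminorm p).

Lemma seminormZ a v : p (a *: v) = Normc.normc a * p v.
Proof. by case: hp. Qed.

Lemma seminormD u v : p (u + v) <= p u + p v.
Proof. by case: hp. Qed.

Lemma seminorm0 : p 0 = 0.
Proof. by rewrite -(scale0r 0) seminormZ Normc.normc0 mul0r. Qed.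

Lemma seminorm_ge0 v : 0 <= p v.
Proof.
have pN : p (- v) = p v.
  by rewrite -scaleN1r seminormZ normcN Normc.normc1 mul1r.
have := seminormD v (- v); rewrite subrr seminorm0 pN; lra.
Qed.

Lemma seminorm_sum (I : Type) (s : seq I) (P : pred I) (f : I -> V) :
  p (\sum_(i <- s | P i) f i) <= \sum_(i <- s | P i) p (f i).
Proof.
elim/big_ind2: _ => [|a x b y lex ley|//]; first by rewrite seminorm0.
exact: le_trans (seminormD x y) (lerD lex ley).
Qed.

End Seminorm.

(* Multiplying [B] by one factor [A - z] at a time reduces the bound to the
   recursion [u_(m+1) <= C r'^m + r u_m]. *)
Lemma seminorm_exp_prod_le (R : realType) (d : nat) (p : 'M[R[i]]_d -> R)
    (hp : seminorm p) (A : 'M[R[i]]_d) (r r' : R) (s : seq R[i]) :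
  0 <= r < r' -> (forall z, z \in s -> Normc.normc z <= r) ->
  forall B : 'M[R[i]]_d, B *m \prod_(z <- s) (A - z%:M) = 0 ->
  exists C, forall m, p (B *m A ^+ m) <= C * r' ^+ m.
Proof.
move=> /andP[r_ge0 ltr]; elim: s => [|z s IHs] sr B.
  rewrite big_nil mulmx1 => ->; exists 0 => m.
  by rewrite mul0mx (seminorm0 hp) mul0r.
have r'_gt0 : 0 < r' by apply: le_lt_trans ltr.
rewrite big_cons -mulmxE mulmxA => /IHs[t ts|C hC].
  by rewrite sr// inE ts orbT.
(* The first term starts the induction; the second gives [C <= D * (r' - r)], exactly what the
   recursion needs to reproduce the bound [D * r' ^+ m]. *)
exists (Num.max (p B) (C / (r' - r))); elim=> [|m IHm].
  by rewrite !expr0 mulmx1 mulr1 le_max lexx.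
set D := Num.max _ _ in IHm *.
have -> : B *m A ^+ m.+1 = B *m (A - z%:M) *m A ^+ m + z *: (B *m A ^+ m).
  rewrite exprS -mulmxE mulmxBr mulmxBl mul_mx_scalar -scalemxAl mulmxA.
  by rewrite subrK.
apply: le_trans (seminormD hp _ _) _; rewrite (seminormZ hp).
have le1 : Normc.normc z * p (B *m A ^+ m) <= r * (D * r' ^+ m).
  by rewrite ler_pM ?normc_ge0 ?(seminorm_ge0 hp)// sr// mem_head.
have le2 : C <= D * (r' - r).
  by rewrite -ler_pdivrMr ?subr_gt0// le_max lexx orbT.
have le3 : C * r' ^+ m <= D * (r' - r) * r' ^+ m.
  by rewrite ler_wpM2r// exprn_ge0// ltW.
have := hC m; rewrite exprS; nra.
Qed.

(** The upper half of Gelfand's formula. By Cayley-Hamilton the product of the factors [A - D i]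
    vanishes, so the preceding bound applies with [B = 1]. *)
Lemma seminorm_exp_le (R : realType) (d : nat) (p : 'M[R[i]]_d -> R)
    (hp : seminorm p) (A : 'M[R[i]]_d) (r r' : R) :
  0 <= r < r' -> (forall a, eigenvalue A a -> Normc.normc a <= r) ->
  exists C, forall m, p (A ^+ m) <= C * r' ^+ m.
Proof.
move=> hr eigA; case: d => [|d] in p hp A eigA *.
  by exists 0 => m; rewrite [_ ^+ _]flatmx0 (seminorm0 hp) mul0r.
have [D chA _] := mxtrace_exp_eigenvalues A.
have [||C hC] := @seminorm_exp_prod_le R d.+1 p hp A r r' [seq D i | i <- index_enum 'I_d.+1] hr _ 1.
- move=> z /mapP[i _ zE]; apply: eigA; rewrite eigenvalue_root_char chA zE /root.
  by rewrite horner_prod; apply/prodf_eq0; exists i; rewrite // hornerXsubC subrr.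
- have := Cayley_Hamilton A; rewrite chA rmorph_prod/= => CH.
  rewrite mul1mx big_map -[RHS]CH; apply: eq_bigr => i _.
  by rewrite rmorphB/= horner_mx_X horner_mx_C.
by exists C => m; have := hC m; rewrite mul1mx.
Qed.

Definition mx_l1 (R : realType) (m n : nat) (A : 'M[R[i]]_(m, n)) : R :=
  \sum_i \sum_j Normc.normc (A i j).

Lemma mx_l1_seminorm (R : realType) (m n : nat) :
  seminorm (@mx_l1 R m n).
Proof.
split=> [a A|A B]; rewrite /mx_l1.
  rewrite mulr_sumr; apply: eq_bigr => i _; rewrite mulr_sumr.
  by apply: eq_bigr => j _; rewrite mxE Normc.normcM.
rewrite -big_split; apply: ler_sum => i _; rewrite -big_split.
by apply: ler_sum => j _; rewrite mxE normcD_le.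
Qed.

Lemma normc_le_mx_l1 (R : realType) (m n : nat) (A : 'M[R[i]]_(m, n)) i j :
  Normc.normc (A i j) <= mx_l1 A.
Proof.
rewrite /mx_l1 (bigD1 i)//= (bigD1 j)//= -addrA lerDl.
by rewrite addr_ge0 ?sumr_ge0// => *; rewrite ?sumr_ge0 ?normc_ge0// => *;
  rewrite normc_ge0.
Qed.

Lemma mx_l1M_le (R : realType) (m n q : nat) (A : 'M[R[i]]_(m, n))
    (B : 'M[R[i]]_(n, q)) : mx_l1 (A *m B) <= mx_l1 A * mx_l1 B.
Proof.
rewrite /mx_l1 mulr_suml; apply: ler_sum => i _; rewrite mulr_suml.
apply: (@le_trans _ _ (\sum_k \sum_j Normc.normc (A i j) * Normc.normc (B j k))).
  apply: ler_sum => k _; rewrite mxE; apply: le_trans (normc_sum_le _ _ _) _.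
  by apply: ler_sum => j _; rewrite Normc.normcM.
rewrite exchange_big; apply: ler_sum => j _; rewrite -mulr_sumr.
rewrite ler_wpM2l ?normc_ge0// (bigD1 j)//= lerDl sumr_ge0// => *.
by rewrite sumr_ge0// => *; rewrite normc_ge0.
Qed.

(** The spectrum is finite, so a strict bound leaves a gap; positivity of [b] covers an empty
    spectrum. *)
Lemma eigenvalue_normc_bound (R : realType) (d : nat) (A : 'M[R[i]]_d) (b : R) :
  0 < b -> (forall a, eigenvalue A a -> Normc.normc a < b) ->
  exists2 r, 0 <= r < b & forall a, eigenvalue A a -> Normc.normc a <= r.
Proof.
move=> b_gt0 eigA; have [D eigP] := eigenvaluesP A.
exists (\big[Num.max/0]_i Normc.normc (D i)).
  rewrite bigmax_ge_id/=; apply: bigmax_lt => // i _.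
  by apply: eigA; apply/eigP; exists i.
by move=> _ /eigP[i ->]; apply: le_bigmax.
Qed.

(** * Almost contracting norms *)

(** Separation is stated quantitatively, as domination of [mx_l1], so that bounds for [nu] turn into
    bounds on entries. *)
Definition vector_norm (R : realType) (d : nat) (nu : 'rV[R[i]]_d -> R) : Prop :=
  seminorm nu /\
  exists2 C, 0 <= C & forall v, mx_l1 v <= C * nu v.

Lemma seminorm_le_mx_l1 (R : realType) (m n : nat) (p : 'M[R[i]]_(m, n) -> R) :
  seminorm p -> exists2 C, 0 <= C & forall A, p A <= C * mx_l1 A.
Proof.
move=> hp; exists (\sum_i \sum_j p (delta_mx i j)) => [|A].
  by rewrite !sumr_ge0// => i _; rewrite sumr_ge0// => j _; apply: seminorm_ge0.
rewrite [A in p A]matrix_sum_delta; apply: le_trans (seminorm_sum hp _ _ _) _.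
rewrite mulr_suml; apply: ler_sum => i _; rewrite mulr_suml.
apply: le_trans (seminorm_sum hp _ _ _) _; apply: ler_sum => j _.
by rewrite (seminormZ hp) mulrC ler_wpM2l ?(seminorm_ge0 hp)// normc_le_mx_l1.
Qed.

(** The coordinates of a product are fixed linear combinations of traces of products, and each such
    trace is a sum of [d] eigenvalues of modulus at most 1. *)
Lemma bounded_products (R : realType) (d : nat) (I : Type) (S : I -> 'M[R[i]]_d)
    (k : nat) (y : 'I_k -> seq I) (G : 'M[R[i]]_k) :
  (forall w a, eigenvalue (\prod_(i <- w) S i) a -> Normc.normc a <= 1) ->
  (forall w, \prod_(i <- w) S i =
     \sum_j (\sum_l \tr (\prod_(i <- w ++ y l) S i) * G l j)
               *: \prod_(i <- y j) S i) ->
  exists M, forall w, mx_l1 (\prod_(i <- w) S i) <= M.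
Proof.
move=> eigS coordS; have hl1 := @mx_l1_seminorm R d d.
exists (\sum_j (\sum_l d%:R * Normc.normc (G l j)) * mx_l1 (\prod_(i <- y j) S i)).
move=> w; rewrite coordS; apply: le_trans (seminorm_sum hl1 _ _ _) _.
apply: ler_sum => j _; rewrite (seminormZ hl1) ler_wpM2r ?(seminorm_ge0 hl1)//.
apply: le_trans (normc_sum_le _ _ _) _; apply: ler_sum => l _.
rewrite Normc.normcM ler_wpM2r ?normc_ge0// -lecR rmorph_nat.
apply: norm_mxtrace_le => a /eigS; rewrite -lecR; exact.
Qed.

(** [nu v] is the supremum of [mx_l1 (v *m P)] over all products [P]. A letter does not increase it,
    because the words starting with that letter are among those already considered; the empty word
    gives the lower bound. *)
Lemma bounded_products_norm (R : realType) (d : nat) (I : Type)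
    (S : I -> 'M[R[i]]_d) (M : R) :
  (forall w, mx_l1 (\prod_(i <- w) S i) <= M) ->
  exists nu, [/\ vector_norm nu, forall i v, nu (v *m S i) <= nu v,
    forall v, mx_l1 v <= nu v & forall v, nu v <= M * mx_l1 v].
Proof.
move=> SM; pose E (v : 'rV[R[i]]_d) := [set mx_l1 (v *m \prod_(i <- w) S i) | w in [set: seq I]].
have EM v : ubound (E v) (M * mx_l1 v).
  move=> _ [w _ <-]; apply: le_trans (mx_l1M_le _ _) _.
  by rewrite mulrC ler_wpM2r ?SM// (seminorm_ge0 (@mx_l1_seminorm R 1 d)).
have supE v : has_sup (E v).
  by split; [exists (mx_l1 (v *m \prod_(i <- [::]) S i)); exists [::]
            | exists (M * mx_l1 v)].
have leE v w : mx_l1 (v *m \prod_(i <- w) S i) <= sup (E v).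
  by apply: ub_le_sup; [case: (supE v) | exists w].
have hl1 := @mx_l1_seminorm R 1 d.
have le1 v : mx_l1 v <= sup (E v).
  by have := leE v [::]; rewrite big_nil mulmx1.
exists (fun v => sup (E v)); split=> //.
- split; last by exists 1 => // v; rewrite mul1r.
  split=> [a v|u v].
    apply/eqP; rewrite eq_le; apply/andP; split.
      apply: ge_sup => [|_ [w _ <-]]; first by case: (supE (a *: v)).
      by rewrite -scalemxAl (seminormZ hl1) ler_wpM2l ?normc_ge0.
    have [->|a_neq0] := eqVneq a 0.
      by rewrite Normc.normc0 mul0r (le_trans _ (le1 _)) ?(seminorm_ge0 hl1).
    have na_gt0 : 0 < Normc.normc a.
      rewrite lt_def normc_ge0 andbT.
      by apply: contra_neq a_neq0; exact: Normc.eq0_normc.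
    rewrite mulrC -ler_pdivlMr//; apply: ge_sup => [|_ [w _ <-]].
      by case: (supE v).
    rewrite ler_pdivlMr// mulrC -(seminormZ hl1) scalemxAl.
    exact: leE.
  apply: ge_sup => [|_ [w _ <-]]; first by case: (supE (u + v)).
  by rewrite mulmxDl (le_trans (seminormD hl1 _ _))// lerD// leE.
- move=> i v; apply: ge_sup => [|_ [w _ <-]]; first by case: (supE (v *m S i)).
  by rewrite -mulmxA; have := leE v (i :: w); rewrite big_cons.
- by move=> v; apply: ge_sup; [case: (supE v) | apply: EM].
Qed.

(** * Invariant subspaces and block triangular norms *)

Lemma eigenvalue_tr (F : fieldType) (d : nat) (A : 'M[F]_d) (a : F) :
  eigenvalue A^T a = eigenvalue A a.
Proof.
rewrite !eigenvalue_root_char /char_poly -det_tr; congr (root (\det _) a).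
by rewrite /char_poly_mx linearB/= tr_scalar_mx map_trmx trmxK.
Qed.

Lemma eigenvalue_sub (F : fieldType) (d r : nat) (A : 'M[F]_d) (B : 'M[F]_r)
    (W : 'M[F]_(r, d)) (L : 'M[F]_(d, r)) (a : F) :
  W *m L = 1%:M -> W *m A = B *m W -> eigenvalue B a -> eigenvalue A a.
Proof.
move=> WL WA /eigenvalueP[x xB x_neq0]; apply/eigenvalueP; exists (x *m W).
  by rewrite -mulmxA WA mulmxA xB scalemxAl.
by apply: contra_neq x_neq0 => xW; rewrite -[x]mulmx1 -WL mulmxA xW mul0mx.
Qed.

(** Transposition exchanges quotients and subspaces and preserves the spectrum. *)
Lemma eigenvalue_quo (F : fieldType) (d r : nat) (A : 'M[F]_d) (C : 'M[F]_r)
    (Q : 'M[F]_(d, r)) (T : 'M[F]_(r, d)) (a : F) :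
  T *m Q = 1%:M -> A *m Q = Q *m C -> eigenvalue C a -> eigenvalue A a.
Proof.
move=> TQ AQ; rewrite -eigenvalue_tr -(eigenvalue_tr A).
apply: (@eigenvalue_sub _ _ _ _ _ Q^T T^T).
  by rewrite -trmx_mul TQ trmx1.
by rewrite -!trmx_mul AQ.
Qed.

(** Coordinates adapted to the row space of [U]: [W] is a basis of it and [Q] the projection to the
    quotient, while [L] and [T] split these two maps. [B] and [C] are the diagonal blocks in this
    decomposition. *)
Lemma invariant_subspace_blocks (F : fieldType) (d k : nat) (U : 'M[F]_(k, d))
    (I : Type) (S : I -> 'M[F]_d) : (forall i, (U *m S i <= U)%MS) ->
  let r := \rank U in let e := \rank (cokermx U) in
  exists (W : 'M[F]_(r, d)) (L : 'M[F]_(d, r)) (Q : 'M[F]_(d, e))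
    (T : 'M[F]_(e, d)) (B : I -> 'M[F]_r) (C : I -> 'M[F]_e),
  [/\ W *m L = 1%:M, T *m Q = 1%:M, L *m W + Q *m T = 1%:M,
      forall i, W *m S i = B i *m W & forall i, S i *m Q = Q *m C i].
Proof.
move=> US r e; pose W := row_base U; pose Q := col_base (cokermx U).
pose T := pinvmx Q.
have TQ : T *m Q = 1%:M by rewrite mulVpmx// col_base_full.
have QK : Q *m row_base (cokermx U) = cokermx U := mulmx_base _.
have cokerQ n (X : 'M[F]_(n, d)) : X *m cokermx U = 0 <-> X *m Q = 0.
  split=> X0.
    have : X *m (Q *m row_base (cokermx U)) = 0 by rewrite QK.
    rewrite mulmxA => /(congr1 (mulmx^~ (pinvmx (row_base (cokermx U))))).
    by rewrite -mulmxA mulmxVp ?row_base_free// mulmx1 mul0mx.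
  have : X *m (Q *m row_base (cokermx U)) = 0 by rewrite mulmxA X0 mul0mx.
  by rewrite QK.
have WQ : W *m Q = 0 by apply/cokerQ/eqP; rewrite -submxE eq_row_base.
(* [1 - Q *m T] is annihilated by [Q], so its rows lie in the row space of [W]. *)
have [L LE] : exists L, 1%:M - Q *m T = L *m W.
  apply/submxP; rewrite eq_row_base submxE; apply/eqP/cokerQ.
  by rewrite mulmxBl mul1mx -mulmxA TQ mulmx1 subrr.
have LW : L *m W + Q *m T = 1%:M by rewrite -LE subrK.
have WL : W *m L = 1%:M.
  have : W *m L *m W = 1%:M *m W.
    by rewrite -mulmxA -LE mulmxBr mulmx1 mulmxA WQ mul0mx subr0 mul1mx.
  by move/(row_free_inj (row_base_free U)).
have /choice[B WB] i : exists B, W *m S i = B *m W.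
  apply/submxP; rewrite eq_row_base; apply: submx_trans (US i).
  by apply: submxMr; rewrite eq_row_base.
clearbody T Q W; exists W, L, Q, T, B, (fun i => T *m S i *m Q); split=> // i.
have -> : S i *m Q = (L *m W + Q *m T) *m S i *m Q by rewrite LW mul1mx.
by rewrite !mulmxDl -(mulmxA L) WB -!mulmxA WQ !mulmx0 add0r.
Qed.

(** The norm is [nuC (v *m Q) + eta * nuB (v *m L)]. The off-diagonal block feeds the quotient
    component into the subspace component, where the small weight [eta] reduces its contribution to
    at most [eps]. *)
Lemma triangular_norm (R : realType) (d r e : nat) (J : finType)
    (W : 'M[R[i]]_(r, d)) (L : 'M[R[i]]_(d, r))
    (Q : 'M[R[i]]_(d, e)) (T : 'M[R[i]]_(e, d))
    (A : J -> 'M[R[i]]_d) (B : J -> 'M[R[i]]_r) (C : J -> 'M[R[i]]_e)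
    (nuB : 'rV[R[i]]_r -> R) (nuC : 'rV[R[i]]_e -> R) (c : J -> R) (eps : R) :
  W *m L = 1%:M -> T *m Q = 1%:M -> L *m W + Q *m T = 1%:M ->
  (forall t, W *m A t = B t *m W) -> (forall t, A t *m Q = Q *m C t) ->
  vector_norm nuB -> vector_norm nuC ->
  (forall t v, nuB (v *m B t) <= c t * nuB v) ->
  (forall t v, nuC (v *m C t) <= c t * nuC v) ->
  0 < eps ->
  exists2 nu, vector_norm nu &
    forall t v, nu (v *m A t) <= (c t + eps) * nu v.
Proof.
move=> WL TQ LWQT WA AQ [hB [kB kB_ge0 hkB]] [hC [kC kC_ge0 hkC]] cB cC eps_gt0.
have [mB mB_ge0 hmB] := seminorm_le_mx_l1 hB.
have l1_ge0 m n (X : 'M[R[i]]_(m, n)) : 0 <= mx_l1 X.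
  exact: seminorm_ge0 (@mx_l1_seminorm R m n) X.
(* One bound for the off-diagonal blocks of all [A t]; the sum exists because [J] is finite. *)
pose M := mB * (kC * \sum_t mx_l1 (T *m A t *m L)).
have M_ge0 : 0 <= M by rewrite !mulr_ge0 ?sumr_ge0.
have hM t x : nuB (x *m (T *m A t *m L)) <= M * nuC x.
  apply: le_trans (hmB _) _; rewrite -mulrA ler_wpM2l//.
  apply: le_trans (mx_l1M_le _ _) _; rewrite mulrAC ler_pM//.
  by rewrite (bigD1 t)//= lerDl sumr_ge0.
pose eta := eps / (M + 1).
have eta_gt0 : 0 < eta by rewrite divr_gt0// ltr_wpDl.
have etaM : eta * M <= eps.
  by rewrite /eta -mulrA ler_piMr ?(ltW eps_gt0)// mulrC ler_pdivrMr ?ltr_wpDl// mul1r lerDl.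
clearbody eta M.
exists (fun v => nuC (v *m Q) + eta * nuB (v *m L)) => [|t v].
  split; first split=> [a v|u v].
  - rewrite -!scalemxAl (seminormZ hC) (seminormZ hB); ring.
  - rewrite !mulmxDl; have := seminormD hC (u *m Q) (v *m Q).
    have := seminormD hB (u *m L) (v *m L); nra.
  exists (kB * mx_l1 W / eta + kC * mx_l1 T) => [|v].
    by rewrite addr_ge0// ?mulr_ge0// ?invr_ge0 ltW.
  have -> : mx_l1 v = mx_l1 (v *m L *m W + v *m Q *m T).
    by rewrite -!mulmxA -mulmxDr LWQT mulmx1.
  apply: le_trans (seminormD (@mx_l1_seminorm _ _ _) _ _) _.
  have h1 := le_trans (mx_l1M_le (v *m L) W) (ler_wpM2r (l1_ge0 _ _ W) (hkB (v *m L))).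
  have h2 := le_trans (mx_l1M_le (v *m Q) T) (ler_wpM2r (l1_ge0 _ _ T) (hkC (v *m Q))).
  have nB := seminorm_ge0 hB (v *m L); have nC := seminorm_ge0 hC (v *m Q).
  apply: le_trans (lerD h1 h2) _.
  rewrite mulrDl !mulrDr.
  have -> : kB * mx_l1 W / eta * (eta * nuB (v *m L)) = kB * nuB (v *m L) * mx_l1 W.
    by rewrite mulrA mulfVK ?gt_eqF// mulrAC.
  have -> : kC * mx_l1 T * nuC (v *m Q) = kC * nuC (v *m Q) * mx_l1 T by ring.
  have p1 : 0 <= kB * mx_l1 W / eta * nuC (v *m Q).
    by rewrite !mulr_ge0// invr_ge0 ltW.
  have p2 : 0 <= kC * mx_l1 T * (eta * nuB (v *m L)).
    by rewrite !mulr_ge0// ltW.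
  lra.
have -> : v *m A t *m Q = v *m Q *m C t by rewrite -!mulmxA AQ.
have -> : v *m A t *m L = v *m L *m B t + v *m Q *m (T *m A t *m L).
  rewrite -[in LHS](mulmx1 v) -LWQT mulmxDr !mulmxDl !mulmxA; congr (_ + _).
  by rewrite -[v *m L *m W *m A t]mulmxA WA -!mulmxA WL mulmx1.
have h1 := seminormD hB (v *m L *m B t) (v *m Q *m (T *m A t *m L)).
have h2 := cB t (v *m L); have h3 := cC t (v *m Q); have h4 := hM t (v *m Q).
have nB := seminorm_ge0 hB (v *m L); have nC := seminorm_ge0 hC (v *m Q).
have h5 : eta * nuB (v *m L *m B t + v *m Q *m (T *m A t *m L)) <=
   eta * (c t * nuB (v *m L) + M * nuC (v *m Q)).
  by apply: ler_wpM2l; [exact: ltW | lra].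
have h6 : eta * M * nuC (v *m Q) <= eps * nuC (v *m Q) by rewrite ler_wpM2r.
have h7 : 0 <= eps * (eta * nuB (v *m L)) by rewrite !mulr_ge0// ltW.
lra.
Qed.

Lemma prod_intertwine (F : nzRingType) (d r : nat) (I : Type) (S : I -> 'M[F]_d)
    (B : I -> 'M[F]_r) (W : 'M[F]_(r, d)) (w : seq I) :
  (forall i, W *m S i = B i *m W) ->
  W *m \prod_(i <- w) S i = \prod_(i <- w) B i *m W.
Proof.
move=> WS; elim: w => [|i w IHw]; first by rewrite !big_nil mulmx1 mul1mx.
by rewrite !big_cons -!mulmxE mulmxA WS -mulmxA IHw mulmxA.
Qed.

Lemma prod_intertwiner (F : nzRingType) (d r : nat) (I : Type) (S : I -> 'M[F]_d)
    (C : I -> 'M[F]_r) (Q : 'M[F]_(d, r)) (w : seq I) :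
  (forall i, S i *m Q = Q *m C i) ->
  \prod_(i <- w) S i *m Q = Q *m \prod_(i <- w) C i.
Proof.
move=> SQ; elim: w => [|i w IHw]; first by rewrite !big_nil mulmx1 mul1mx.
by rewrite !big_cons -!mulmxE -mulmxA IHw mulmxA SQ mulmxA.
Qed.

Lemma exp_lt_eventually (R : realType) (C r e : R) :
  0 <= r < 1 -> 0 < e -> exists q0, forall q, (q0 <= q)%N -> C * r ^+ q <= e.
Proof.
move=> /andP[r_ge0 r_lt1] e_gt0.
have /cvgrPdist_le/(_ e e_gt0)[q0 _ hq0] : C * r ^+ q @[q --> \oo] --> C * 0.
  by apply: cvgMr; apply: cvg_expr; rewrite ger0_norm.
exists q0 => q /hq0; rewrite mulr0 sub0r normrN; exact: le_trans (ler_norm _).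
Qed.

(** The supremum norm lies between [mx_l1] and [M] times [mx_l1], so the geometric decay of the
    powers of the [w0] product eventually beats the constants. *)
Lemma bounded_products_contracting_norm (R : realType) (d : nat) (I : Type)
    (S : I -> 'M[R[i]]_d) (w0 : seq I) (M : R) :
  (forall w, mx_l1 (\prod_(i <- w) S i) <= M) ->
  (forall a, eigenvalue (\prod_(i <- w0) S i) a -> Normc.normc a < 1) ->
  exists2 nu, vector_norm nu & (forall i v, nu (v *m S i) <= nu v) /\
    exists q0, forall q, (q0 <= q)%N ->
    forall v, nu (v *m (\prod_(i <- w0) S i) ^+ q) <= 2^-1 * nu v.
Proof.
move=> SM eigw0; set A := \prod_(i <- w0) S i in eigw0 *.
have [nu [hnu nuS le1 leM]] := bounded_products_norm SM.
exists nu => //; split=> //.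
have [r /andP[r_ge0 r_lt1] eigA] := eigenvalue_normc_bound ltr01 eigw0.
have [|C hC] := @seminorm_exp_le R d _ (@mx_l1_seminorm R d d) A r ((r + 1) / 2) _ eigA.
  by rewrite r_ge0/=; lra.
have M_ge0 : 0 <= M.
  exact: le_trans (seminorm_ge0 (@mx_l1_seminorm R d d) _) (SM [::]).
have [||q0 hq0] := @exp_lt_eventually R (M * C) ((r + 1) / 2) 2^-1.
- by apply/andP; split; lra.
- by lra.
exists q0 => q /hq0 leq v; apply: le_trans (leM _) _.
have nuv : 0 <= nu v by apply: seminorm_ge0; case: hnu.
apply: (@le_trans _ _ (M * (C * ((r + 1) / 2) ^+ q) * nu v)).
  rewrite -mulrA ler_wpM2l//; apply: le_trans (mx_l1M_le _ _) _.
  by rewrite mulrC ler_pM// (seminorm_ge0 (@mx_l1_seminorm _ _ _)).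
by rewrite mulrA ler_wpM2r.
Qed.

(** Strong induction on the dimension. The threshold [q0] precedes [eps]: later [q] determines the
    measure of a cylinder, and [eps] is chosen according to that measure. *)
Lemma almost_contracting_norm (R : realType) (I : finType) (w0 : seq I) (d : nat)
    (S : I -> 'M[R[i]]_d) :
  (forall w a, eigenvalue (\prod_(i <- w) S i) a -> Normc.normc a <= 1) ->
  (forall a, eigenvalue (\prod_(i <- w0) S i) a -> Normc.normc a < 1) ->
  exists q0, forall q, (q0 <= q)%N -> forall eps, 0 < eps ->
    exists2 nu, vector_norm nu &
      (forall i v, nu (v *m S i) <= (1 + eps) * nu v) /\
      forall v, nu (v *m (\prod_(i <- w0) S i) ^+ q) <= (2^-1 + eps) * nu v.
Proof.
have [n] := ubnP d; elim: n => // n IHn in d S *.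
rewrite ltnS => le_dn eigS eigw0.
have [[k [U [/andP[U_gt0 U_ltd] US]]]|[k [y [G coordS]]]] :=
    invariant_subspace_or_trace_coordinates S; last first.
  have [M SM] := bounded_products eigS coordS.
  have [nu hnu [nuS [q0 hq0]]] := bounded_products_contracting_norm SM eigw0.
  have nu_ge0 := seminorm_ge0 (proj1 hnu).
  exists q0 => q /hq0 leq eps eps_gt0; exists nu => //; split=> [i v|v].
    by apply: le_trans (nuS i v) _; rewrite ler_peMl//; lra.
  by apply: le_trans (leq v) _; rewrite ler_wpM2r//; lra.
have [W [L [Q [T [B [C [WL TQ LWQT WS SQ]]]]]]] := invariant_subspace_blocks US.
have eigB w a : eigenvalue (\prod_(i <- w) B i) a -> eigenvalue (\prod_(i <- w) S i) a.
  exact: eigenvalue_sub WL (prod_intertwine _ WS).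
have eigC w a : eigenvalue (\prod_(i <- w) C i) a -> eigenvalue (\prod_(i <- w) S i) a.
  exact: eigenvalue_quo TQ (prod_intertwiner _ SQ).
have [|w a /eigB/eigS//|a /eigB/eigw0//|qB hqB] := IHn _ B.
  exact: leq_trans U_ltd le_dn.
have [|w a /eigC/eigS//|a /eigC/eigw0//|qC hqC] := IHn _ C.
  apply: leq_trans le_dn; rewrite mxrank_coker ltn_subrL U_gt0.
  exact: leq_trans U_ltd.
exists (maxn qB qC) => q; rewrite geq_max => /andP[/hqB {}hqB /hqC {}hqC] eps eps_gt0.
have eps2_gt0 : 0 < eps / 2 by lra.
have [nuB nnB [nuBS nuBw]] := hqB _ eps2_gt0.
have [nuC nnC [nuCS nuCw]] := hqC _ eps2_gt0.
(* The letters ([Some i]) and the power of the [w0] product ([None]) form one finite family, so a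
   single norm serves both. Half of [eps] goes to the blocks and half to the gluing. *)
pose A m (X : I -> 'M[R[i]]_m) (t : option I) :=
  if t is Some i then X i else (\prod_(i <- w0) X i) ^+ q.
have prodX m (X : I -> 'M[R[i]]_m) :
    (\prod_(i <- w0) X i) ^+ q = \prod_(i <- flatten (nseq q w0)) X i.
  rewrite big_flatten/=; elim: (q) => [|l IHl]; first by rewrite big_nil.
  by rewrite big_cons -IHl exprS.
pose c (t : option I) : R := (if t is Some _ then 1 else 2^-1) + eps / 2.
have [||||nu hnu nuA] := @triangular_norm R d _ _ (option I) W L Q T (A _ S) (A _ B)
  (A _ C) nuB nuC c (eps / 2) WL TQ LWQT _ _ nnB nnC _ _ eps2_gt0.
- by case=> [i|]/=; rewrite ?WS// !prodX; apply: prod_intertwine.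
- by case=> [i|]/=; rewrite ?SQ// !prodX; apply: prod_intertwiner.
- by case.
- by case.
exists nu => //; split=> [i v|v].
  have := nuA (Some i) v; rewrite /A/c/=; congr (_ <= _ * _); lra.
by have := nuA None v; rewrite /A/c/=; congr (_ <= _ * _); lra.
Qed.

(** * The generalized spectral radius *)

Lemma eigenvalue_le_spectral_radius (R : realType) (d : nat) (A : 'M[R[i]]_d) a :
  eigenvalue A a -> Normc.normc a <= spectral_radius A.
Proof.
move=> Aa; apply: ub_le_sup; last by exists a.
have [D DP] := eigenvaluesP A.
exists (\big[Num.max/0]_i Normc.normc (D i)) => _ [b /DP[i ->] <-].
exact: le_bigmax.
Qed.

Lemma spectral_radius_attained (R : realType) (d : nat) (A : 'M[R[i]]_d) :
  (0 < d)%N -> exists2 a, eigenvalue A a & spectral_radius A = Normc.normc a.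
Proof.
move=> d_gt0; have [D DP] := eigenvaluesP A.
have [i _ imax] := @arg_maxP _ _ _ (Ordinal d_gt0) xpredT (fun i => Normc.normc (D i)) isT.
exists (D i); first by apply/DP; exists i.
apply/eqP; rewrite eq_le eigenvalue_le_spectral_radius ?andbT; last first.
  by apply/DP; exists i.
apply: ge_sup; first by exists (Normc.normc (D i)), (D i) => //; apply/DP; exists i.
by move=> _ [b /DP[j ->] <-]; apply: imax.
Qed.

Lemma eigenvalue_exp (F : fieldType) (d : nat) (A : 'M[F]_d) (a : F) (k : nat) :
  eigenvalue A a -> eigenvalue (A ^+ k) (a ^+ k).
Proof.
move=> /eigenvalueP[v vA v_neq0]; apply/eigenvalueP; exists v => //.
elim: k => [|k IHk]; first by rewrite !expr0 mulmx1 scale1r.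
by rewrite exprS -mulmxE mulmxA vA -scalemxAl IHk scalerA exprS.
Qed.

Lemma spectral_radius_exp_ge (R : realType) (d : nat) (A : 'M[R[i]]_d) (k : nat) :
  (0 < d)%N -> spectral_radius A ^+ k <= spectral_radius (A ^+ k).
Proof.
move=> /(spectral_radius_attained A)[a Aa ->]; rewrite -normcX.
by apply: eigenvalue_le_spectral_radius; apply: eigenvalue_exp.
Qed.

Section SubmultiplicativeNorm.
Context (R : realType) (d : nat) (N : 'M[R[i]]_d -> R).
Hypothesis hN : submultiplicative_norm N.

Lemma submultiplicative_norm_seminorm : seminorm N.
Proof. by case: hN. Qed.

Let hsN := submultiplicative_norm_seminorm.

Lemma submultiplicative_norm_prod_le (C : R) (I : Type) (S : I -> 'M[R[i]]_d)
    (w : seq I) : (0 < size w)%N ->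
  0 <= C -> (forall i, N (S i) <= C) ->
  N (\prod_(i <- w) S i) <= C ^+ size w.
Proof.
move=> + C_ge0 SC; case: w => // i w _; elim: w i => [|j w IHw] i.
  by rewrite big_seq1 expr1.
rewrite big_cons [size _]/= exprS; case: hN => _ _ _ hM.
by apply: le_trans (hM _ _) _; rewrite ler_pM ?(seminorm_ge0 hsN).
Qed.

(* The matrix whose rows all equal an eigenvector is multiplied by the
   eigenvalue. *)
Lemma eigenvalue_le_norm (A : 'M[R[i]]_d) a :
  eigenvalue A a -> Normc.normc a <= N A.
Proof.
move=> /eigenvalueP[v vA /rV0Pn[j vj]].
pose V : 'M[R[i]]_d := \matrix_i v.
have VA : V *m A = a *: V.
  by apply/row_matrixP => i; rewrite row_mul linearZ/= !rowK.
case: hN => N0 NZ _ NM; have := NM V A; rewrite VA NZ mulrC ler_pM2l//.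
rewrite lt_def (seminorm_ge0 hsN) andbT; apply: contra_neq vj => /N0 /matrixP.
by move=> /(_ j j); rewrite !mxE.
Qed.

End SubmultiplicativeNorm.

Lemma powR_exp_root (R : realType) (x : R) (k n : nat) :
  0 <= x -> (0 < k)%N -> (x ^+ k) `^ (k * n)%:R^-1 = x `^ n%:R^-1.
Proof.
move=> x_ge0 k_gt0; rewrite -powR_mulrn// -powRrM natrM invfM mulrA divff ?mul1r//.
by rewrite pnatr_eq0 -lt0n.
Qed.

(** Boundedness identifies the real-valued [limn_sup] with the infimum of the suprema of the
    tails. *)
Lemma le_limn_sup_frequently (R : realType) (u : nat -> R) (c : R) :
  (exists M, forall n, `|u n| <= M) ->
  (forall n, exists2 m, (n <= m)%N & c <= u m) -> c <= limn_sup u.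
Proof.
move=> bu cu; rewrite limn_supE; last first.
  have [M uM] := bu; exists M; split=> [|x ltMx n _]; first exact: num_real.
  exact: le_trans (uM n) (ltW ltMx).
apply: lb_le_inf; first by exists (sups u 0), 0%N.
move=> _ [n _ <-]; have [m le_nm cum] := cu n.
apply: le_trans cum _; apply: ub_le_sup; last by exists m.
by have [M uM] := bu; exists M => _ [k _ <-]; apply: le_trans (ler_norm _) _.
Qed.

(** The repetitions of [w] attain at least the value of [w] along the multiples of its length; [N]
    provides the boundedness of the sequence. *)
Lemma spectral_radius_le_gen_spectral_radius (R : realType) (d K : nat)
    (S : 'I_K -> 'M[R[i]]_d) (N : 'M[R[i]]_d -> R) (w : seq 'I_K) :
  submultiplicative_norm N -> (0 < d)%N -> (0 < size w)%N ->
  spectral_radius (\prod_(i <- w) S i) `^ (size w)%:R^-1 <= gen_spectral_radius S.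
Proof.
move=> hN d_gt0 w_gt0; have hsN := submultiplicative_norm_seminorm hN.
pose C := \big[Num.max/1]_i N (S i).
have C_ge1 : 1 <= C by apply: bigmax_ge_id.
have SC i : N (S i) <= C by apply: le_bigmax.
have sr_ge0 (A : 'M[R[i]]_d) : 0 <= spectral_radius A.
  by have [a _ ->] := spectral_radius_attained A d_gt0; apply: normc_ge0.
apply: le_limn_sup_frequently.
  exists C => n; rewrite ger0_norm; last exact: bigmax_ge_id.
  apply: bigmax_le => [|v _]; first exact: le_trans ler01 _.
  (* At [n = 0] the exponent is the inverse of 0, that is 0, and the root equals 1; this is why [C]
     is at least 1. *)
  have [n0|n_gt0] := posnP n; first by rewrite (_ : n%:R = 0) ?n0// invr0 powRr0.
  have [a Aa ->] := spectral_radius_attained (\prod_(k < n) S (tnth v k)) d_gt0.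
  have := eigenvalue_le_norm hN Aa.
  have <- : \prod_(i <- v) S i = \prod_(k < n) S (tnth v k) by rewrite big_tuple.
  move=> leN.
  have le := le_trans leN (submultiplicative_norm_prod_le hN _ _ SC).
  rewrite size_tuple in le.
  apply: (@le_trans _ _ ((C ^+ n) `^ n%:R^-1)).
    rewrite ge0_ler_powR ?nnegrE ?invr_ge0 ?normc_ge0 ?exprn_ge0 ?le//; lra.
  by rewrite -[X in X%:R^-1]muln1 powR_exp_root ?invr1 ?powRr1//; lra.
move=> n; exists (n.+1 * size w)%N.
  by rewrite (leq_trans (leqnSn n))// leq_pmulr.
have sz : size (flatten (nseq n.+1 w)) == (n.+1 * size w)%N.
  by rewrite size_flatten /shape map_nseq sumn_nseq mulnC.
have prodX : \prod_(i <- flatten (nseq n.+1 w)) S i = (\prod_(i <- w) S i) ^+ n.+1.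
  rewrite big_flatten; elim: n.+1 => [|m IHm]; first by rewrite /= big_nil.
  by rewrite [nseq _ _]/= big_cons IHm exprS.
apply: le_trans (le_bigmax _ _ (Tuple sz)).
have <- : \prod_(i <- Tuple sz) S i = \prod_(k < _) S (tnth (Tuple sz) k).
  by rewrite big_tuple.
rewrite prodX.
move: (\prod_(i <- w) S i) => A.
have := spectral_radius_exp_ge A n.+1 d_gt0.
have := powR_exp_root (size w) (sr_ge0 A) (ltn0Sn n); have := sr_ge0 A.
move: (spectral_radius (A ^+ n.+1)) => b.
move: (n.+1 * size w)%N => m.
move: (spectral_radius A) => a a_ge0 <- leab.
by apply: ge0_ler_powR; rewrite ?nnegrE ?invr_ge0 ?exprn_ge0 ?ler0n// (le_trans _ leab)// exprn_ge0.
Qed.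

(** * Frequent visits force decay *)

(** The rows of [A] are the images of the basis vectors, so a bound on the action of [A] for [nu]
    controls its entries, with a constant independent of [A]. *)
Lemma seminorm_le_vector_norm (R : realType) (d : nat) (N : 'M[R[i]]_d -> R)
    (nu : 'rV[R[i]]_d -> R) : seminorm N -> vector_norm nu ->
  exists2 C, 0 <= C & forall (A : 'M[R[i]]_d) (b : R), 0 <= b ->
    (forall v, nu (v *m A) <= b * nu v) -> N A <= C * b.
Proof.
move=> hN [hnu [k k_ge0 hk]]; have [C C_ge0 hC] := seminorm_le_mx_l1 hN.
pose D := \sum_i nu (delta_mx 0 i : 'rV_d).
have D_ge0 : 0 <= D by rewrite sumr_ge0// => i _; apply: seminorm_ge0.
exists (C * (k * D)) => [|A b b_ge0 Ab]; first by rewrite !mulr_ge0.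
apply: le_trans (hC A) _; rewrite -mulrA ler_wpM2l//.
have -> : mx_l1 A = \sum_i mx_l1 ((delta_mx 0 i : 'rV_d) *m A).
  by apply: eq_bigr => i _; rewrite -rowE /mx_l1 big_ord1; apply: eq_bigr => j _; rewrite mxE.
rewrite /D mulr_sumr mulr_suml; apply: ler_sum => i _.
by apply: le_trans (hk _) _; rewrite -mulrA ler_wpM2l// mulrC Ab.
Qed.

Lemma prod_scale (F : comNzRingType) (d : nat) (I : Type) (S : I -> 'M[F]_d) (c : F)
    (w : seq I) :
  \prod_(i <- w) (c *: S i) = c ^+ size w *: \prod_(i <- w) S i.
Proof.
elim: w => [|i w IHw]; first by rewrite !big_nil expr0 scale1r.
by rewrite !big_cons IHw -!mulmxE -scalemxAl -scalemxAr scalerA exprS.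
Qed.

Lemma eigenvalue_scale (F : fieldType) (d : nat) (A : 'M[F]_d) (c a : F) :
  c != 0 -> eigenvalue (c *: A) a -> eigenvalue A (c^-1 * a).
Proof.
move=> c_neq0 /eigenvalueP[v vA v_neq0]; apply/eigenvalueP; exists v => //.
by rewrite -scalerA -vA -scalemxAr scalerA mulVf// scale1r.
Qed.

Lemma eigenvalue1 (F : fieldType) (d : nat) (a : F) :
  eigenvalue (1 : 'M[F]_d) a -> a = 1.
Proof.
move=> /eigenvalueP[v]; rewrite mulmx1 => va /rV0Pn[j vj].
have /matrixP/(_ 0 j) := va; rewrite mxE -[LHS]mul1r => /eqP.
by rewrite -subr_eq0 -mulrBl mulf_eq0 (negPf vj) orbF subr_eq0 => /eqP.
Qed.

Lemma powR_root_le (R : realType) (x r : R) (n : nat) :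
  0 <= x -> (0 < n)%N -> x `^ n%:R^-1 <= r -> x <= r ^+ n.
Proof.
move=> x_ge0 n_gt0 le_r; rewrite -[x]powRr1// -[1](@mulVf _ n%:R) ?pnatr_eq0 -?lt0n//.
by rewrite powRrM powR_mulrn ?powR_ge0// lerXn2r ?nnegrE ?powR_ge0// (le_trans _ le_r) ?powR_ge0.
Qed.

Lemma powR_root_lt (R : realType) (x r : R) (n : nat) :
  0 <= x -> (0 < n)%N -> x `^ n%:R^-1 < r -> x < r ^+ n.
Proof.
move=> x_ge0 n_gt0 lt_r; rewrite -[x]powRr1// -[1](@mulVf _ n%:R) ?pnatr_eq0 -?lt0n//.
by rewrite powRrM powR_mulrn ?powR_ge0// ltrXn2r ?nnegrE ?powR_ge0 ?lt_r -?lt0n//.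
Qed.

(** After division of the letters by [r], the almost contracting norm applies. Read block by block,
    each block costs at most a factor [(1 + eps) ^+ m], where [m] is the block length, and each copy
    of the repeated [w0] gains a further factor [2^-1 + eps]. *)
Lemma norm_blocks_le (R : realType) (d : nat) (I : finType) (S : I -> 'M[R[i]]_d)
    (N : 'M[R[i]]_d -> R) (r : R) (w0 : seq I) :
  seminorm N -> 0 < r ->
  (forall w a, (0 < size w)%N -> eigenvalue (\prod_(i <- w) S i) a ->
     Normc.normc a <= r ^+ size w) ->
  (forall a, eigenvalue (\prod_(i <- w0) S i) a -> Normc.normc a < r ^+ size w0) ->
  exists2 q, (0 < q)%N & forall eps, 0 < eps -> exists2 C, 0 <= C &
    forall vs : seq (seq I), all (fun v => size v == q * size w0)%N vs ->
    N (\prod_(i <- flatten vs) S i) <=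
      C * (r ^+ (q * size w0) * (1 + eps) ^+ (q * size w0)) ^+ size vs *
      (2^-1 + eps) ^+ count_mem (flatten (nseq q w0)) vs.
Proof.
move=> hN r_gt0 eigS eigw0.
have r_neq0 : r%:C%C != 0 :> R[i] by rewrite (inj_eq (@complexI R)) gt_eqF.
pose S' i := (r%:C%C)^-1 *: S i.
have normr n : Normc.normc ((r%:C%C : R[i])^-1 ^+ n)^-1 = r ^+ n.
  rewrite -exprVn invrK normcX; congr (_ ^+ _).
  by rewrite /Normc.normc/= expr0n/= addr0 sqrtr_sqr ger0_norm// ltW.
have eigS' w a : eigenvalue (\prod_(i <- w) S' i) a ->
    eigenvalue (\prod_(i <- w) S i) (((r%:C%C)^-1 ^+ size w)^-1 * a).
  by rewrite prod_scale; apply: eigenvalue_scale; rewrite expf_neq0// invr_eq0.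
have [|a|q0 hq0] := @almost_contracting_norm R I w0 d S'.
(* The empty word, excluded from the hypothesis on [S], has the identity as product. *)
- case=> [|i w] a; first by rewrite big_nil => /eigenvalue1 ->; rewrite Normc.normc1.
  move=> /eigS' Sa; have := eigS (i :: w) _ isT Sa; rewrite Normc.normcM normr.
  by rewrite ger_pMr ?exprn_gt0.
- move=> /eigS'/eigw0; rewrite Normc.normcM normr.
  by rewrite gtr_pMr ?exprn_gt0.
(* The successor guarantees a positive exponent. *)
exists q0.+1 => // eps eps_gt0; set m := (_ * _)%N; set w := flatten _.
clearbody m.
have [nu hnu [nuS nuw]] := hq0 _ (leqnSn q0) _ eps_gt0.
have {nuw} nuw v : nu (v *m \prod_(i <- w) S' i) <= (2^-1 + eps) * nu v.
  have -> : \prod_(i <- w) S' i = (\prod_(i <- w0) S' i) ^+ q0.+1 by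
    rewrite /w big_flatten; elim: (q0.+1) => [|l IHl];
      rewrite ?(big_nil, expr0) // [nseq _ _]/= big_cons IHl exprS.
  exact: nuw.
have nu_ge0 := seminorm_ge0 (proj1 hnu).
have nuP u v : nu (v *m \prod_(i <- u) S' i) <= (1 + eps) ^+ size u * nu v.
  elim: u v => [|i u IHu] v; first by rewrite big_nil mulmx1 mul1r.
  rewrite big_cons -mulmxE mulmxA; apply: le_trans (IHu _) _.
  by rewrite exprS -mulrA mulrCA ler_wpM2l ?nuS// exprn_ge0//; lra.
have [C C_ge0 hC] := seminorm_le_vector_norm hN hnu.
exists C => // vs hvs.
have -> : \prod_(i <- flatten vs) S i =
    ((r%:C%C)^-1 ^+ size (flatten vs))^-1 *: \prod_(i <- flatten vs) S' i.
  by rewrite prod_scale scalerA mulVf ?scale1r// expf_neq0// invr_eq0.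
have -> : size (flatten vs) = (m * size vs)%N.
  elim: vs hvs => [|v vs IHvs]/=; first by rewrite muln0.
  by move=> /andP[/eqP sv /IHvs IH]; rewrite size_cat IH sv mulnS.
rewrite (seminormZ hN) normr exprMn -!exprM mulrCA -!mulrA ler_wpM2l//.
  by rewrite exprn_ge0// ltW.
apply: hC => [|v]; first by rewrite mulr_ge0// exprn_ge0//; lra.
elim: vs hvs v => [|u vs IHvs]/= hvs v; first by rewrite big_nil mulmx1 muln0 !expr0 !mul1r.
move: hvs => /andP[/eqP su /IHvs {}IHvs].
rewrite big_cat/= mulmxA; apply: le_trans (IHvs _) _.
rewrite mulnS !exprD.
set X := _ ^+ (m * _); set Y := _ ^+ count_mem _ _.
have X_ge0 : 0 <= X by rewrite exprn_ge0//; lra.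
have Y_ge0 : 0 <= Y by rewrite exprn_ge0//; lra.
suff key : nu (v *m \prod_(i <- u) S' i) <=
    (1 + eps) ^+ m * (2^-1 + eps) ^+ (u == w) * nu v.
  apply: le_trans (ler_wpM2l (mulr_ge0 X_ge0 Y_ge0) key) _.
  by rewrite le_eqVlt; apply/orP; left; apply/eqP; ring.
have [uw|_] := eqVneq u w; last by rewrite mulr1 -su.
rewrite uw expr1; apply: le_trans (nuw v) _; rewrite -mulrA ler_peMl//.
  by rewrite mulr_ge0//; lra.
by rewrite exprn_ege1//; lra.
Qed.

Lemma prod_mkseq (F : nzRingType) (d : nat) (I : Type) (S : I -> 'M[F]_d)
    (x : nat -> I) (n : nat) :
  \prod_(i <- mkseq x n) S i = \prod_(k < n) S (x k).
Proof. by rewrite big_map -[n in iota 0 n]subn0 big_mkord. Qed.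

Definition block (I : Type) (x : nat -> I) (m j : nat) : seq I :=
  mkseq (fun k => x (j * m + k)%N) m.

Lemma flatten_blocks (I : Type) (x : nat -> I) (m n : nat) :
  flatten [seq block x m j | j <- iota 0 n] = mkseq x (n * m).
Proof.
elim: n => [//|n IHn]; rewrite -addn1 iotaD map_cat flatten_cat IHn/= cats0.
rewrite addn1 mulSnr /mkseq iotaD map_cat add0n; congr (_ ++ _).
have -> : iota (n * m) m = map (addn (n * m)) (iota 0 m) by rewrite -iotaDl addn0.
by rewrite -map_comp.
Qed.

Lemma le_exp_root (R : realType) (x c : R) (n : nat) :
  0 <= x -> 0 <= c -> (0 < n)%N -> x <= c ^+ n -> x `^ n%:R^-1 <= c.
Proof.
move=> x_ge0 c_ge0 n_gt0 le_x; have -> : c = (c ^+ n) `^ n%:R^-1.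
  by have := @powR_exp_root R c n 1 c_ge0 n_gt0; rewrite muln1 invr1 powRr1// => ->.
by apply: ge0_ler_powR; rewrite ?nnegrE ?invr_ge0 ?exprn_ge0 ?ler0n.
Qed.

Lemma powR_lt1 (R : realType) (x p : R) : 0 <= x < 1 -> 0 < p -> x `^ p < 1.
Proof.
move=> /andP[x_ge0 x_lt1] p_gt0.
have := @gt0_ltr_powR R p p_gt0 x 1; rewrite powR1; apply; rewrite ?nnegrE//.
Qed.

Lemma powR_gt1 (R : realType) (x p : R) : 1 < x -> 0 < p -> 1 < x `^ p.
Proof.
move=> x_gt1 p_gt0.
have := @gt0_ltr_powR R p p_gt0 1 x; rewrite powR1; apply; rewrite ?nnegrE//.
by rewrite ltW// (lt_trans ltr01).
Qed.

(** If a proportion [delta] of the first [n] blocks were copies of the repeated [w0], the product of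
    length [n * m] would be exponentially smaller than [r ^+ (n * m)], where [m] is the block
    length, against convergence of the roots to [r]. *)
Lemma rare_visits (R : realType) (d K : nat) (S : 'I_K -> 'M[R[i]]_d)
    (N : 'M[R[i]]_d -> R) (r : R) (w0 : seq 'I_K) :
  seminorm N -> 0 < r -> (0 < size w0)%N ->
  (forall w a, (0 < size w)%N -> eigenvalue (\prod_(i <- w) S i) a ->
     Normc.normc a <= r ^+ size w) ->
  (forall a, eigenvalue (\prod_(i <- w0) S i) a -> Normc.normc a < r ^+ size w0) ->
  exists2 q, (0 < q)%N & forall delta, 0 < delta -> forall x : nat -> 'I_K,
    N (\prod_(k < n) S (x k)) `^ n%:R^-1 @[n --> \oo] --> r ->
    exists n0, forall n, (n0 <= n)%N ->
      (count_mem (flatten (nseq q w0))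
        [seq block x (q * size w0) j | j <- iota 0 n])%:R < delta * n%:R :> R.
Proof.
move=> hN r_gt0 w0_gt0 eigS eigw0.
have [q q_gt0 hq] := norm_blocks_le hN r_gt0 eigS eigw0.
exists q => // delta delta_gt0 x cvgx.
set w := flatten _; have : (0 < q * size w0)%N by rewrite muln_gt0 q_gt0.
move: hq; rewrite -/w; move: (q * size w0)%N => m hq m_gt0.
(* The gain per block at visit frequency [delta], since [2^-1 + eps] will be at most 3/4. *)
pose rho := (3 / 4 : R) `^ delta.
have rho_gt0 : 0 < rho by apply: powR_gt0; lra.
have rho_lt1 : rho < 1.
  by apply: powR_lt1 => //; apply/andP; split; lra.
(* [rho < kappa < lambda < 1]: the first gap absorbs [(1 + eps) ^+ m], the second absorbs [C], and
   the last contradicts the convergence. *)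
pose kappa := (1 + rho) / 2; pose lambda := (1 + kappa) / 2.
have kappa_gt0 : 0 < kappa by rewrite /kappa; lra.
have kappa_lt1 : kappa < 1 by rewrite /kappa; lra.
have lambda_gt0 : 0 < lambda by rewrite /lambda; lra.
have lambda_lt1 : lambda < 1 by rewrite /lambda; lra.
have root_gt1 : 1 < (kappa / rho) `^ m%:R^-1.
  apply: powR_gt1; last by rewrite invr_gt0 ltr0n.
  by rewrite ltr_pdivlMr// mul1r /kappa; lra.
pose eps := Num.min (1 / 4) ((kappa / rho) `^ m%:R^-1 - 1).
have eps_gt0 : 0 < eps by rewrite lt_min subr_gt0 root_gt1 andbT; lra.
have eps_le : eps <= 1 / 4 by rewrite ge_min lexx.
have epsm : (1 + eps) ^+ m <= kappa / rho.
  have -> : kappa / rho = ((kappa / rho) `^ m%:R^-1) ^+ m.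
    rewrite -powR_mulrn ?powR_ge0// -powRrM mulVf ?powRr1//.
      by rewrite divr_ge0 ?ltW.
    by rewrite pnatr_eq0 -lt0n.
  rewrite lerXn2r ?nnegrE ?powR_ge0//; first lra.
  by rewrite -lerBrDl ge_min lexx orbT.
have [C C_ge0 hC] := hq _ eps_gt0.
(* The rate [lambda] per block, converted to a rate per letter. *)
pose kappa2 := lambda `^ m%:R^-1.
have kappa2_ge0 : 0 <= kappa2 by apply: powR_ge0.
have kappa2_lt1 : kappa2 < 1.
  by apply: powR_lt1; rewrite ?invr_gt0 ?ltr0n// ltW.
have kappa2E : kappa2 ^+ m = lambda.
  rewrite -powR_mulrn// -powRrM mulVf ?powRr1// ?ltW//.
  by rewrite pnatr_eq0 -lt0n.
have [n1 _ hn1] : \forall n \near \oo,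
    r * kappa2 < N (\prod_(k < n) S (x k)) `^ n%:R^-1.
  by apply: (cvgr_gt r cvgx); rewrite gtr_pMr.
have [||n2 hn2] := @exp_lt_eventually R C (kappa / lambda) 1.
- rewrite divr_ge0 ?(ltW lambda_gt0) ?(ltW kappa_gt0)//= ltr_pdivrMr// mul1r.
  by rewrite /lambda; lra.
- exact: ltr01.
(* The successor makes [n] positive. As [n <= n * m], the lower bound from convergence is available
   at the index [n * m]. *)
exists (maxn n1 n2).+1 => n; rewrite -maxnSS geq_max => /andP[lt1 lt2].
rewrite ltNge; apply/negP => le_count.
set P := \prod_(k < n * m) S (x k).
have n_gt0 : (0 < n)%N by apply: leq_ltn_trans lt1.
have lowerN : (r ^+ m * lambda) ^+ n < N P.
  rewrite ltNge; apply/negP => leN.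
  have := hn1 (n * m)%N (leq_trans (ltnW lt1) (leq_pmulr _ m_gt0)); apply/negP.
  rewrite -leNgt; apply: le_exp_root.
  - exact: seminorm_ge0.
  - exact: mulr_ge0 (ltW r_gt0) kappa2_ge0.
  - by rewrite muln_gt0 n_gt0.
  - by rewrite -/P [in leRHS]mulnC exprM exprMn kappa2E.
have := hC [seq block x m j | j <- iota 0 n].
rewrite flatten_blocks prod_mkseq -/P size_map size_iota.
have -> : all (fun v => size v == m) [seq block x m j | j <- iota 0 n].
  by apply/allP => _ /mapP[j _ ->]; rewrite size_mkseq.
move=> /(_ isT); set c := count_mem _ _ in le_count *; apply/negP; rewrite -ltNge.
apply: le_lt_trans lowerN.
have rm_ge0 : 0 <= r ^+ m by rewrite exprn_ge0// ltW.
have countE : (2^-1 + eps) ^+ c <= rho ^+ n.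
  apply: (@le_trans _ _ ((3 / 4) ^+ c)).
    by rewrite lerXn2r ?nnegrE//; lra.
  have -> : (3 / 4 : R) ^+ c = (3 / 4) `^ c%:R by rewrite powR_mulrn//; lra.
  have -> : rho ^+ n = (3 / 4) `^ (delta * n%:R).
    by rewrite powRrM powR_mulrn ?powR_ge0.
  apply: ger_powR; first by apply/andP; split; lra.
  exact: le_count.
have eps1_ge0 : 0 <= 1 + eps by lra.
have eps2_ge0 : 0 <= 2^-1 + eps by lra.
have rmeps_ge0 : 0 <= r ^+ m * (1 + eps) ^+ m by rewrite mulr_ge0// exprn_ge0.
have rmeps_le : r ^+ m * (1 + eps) ^+ m <= r ^+ m * (kappa / rho).
  by rewrite ler_wpM2l.
have rmeps_exp_le : (r ^+ m * (1 + eps) ^+ m) ^+ n <= (r ^+ m * (kappa / rho)) ^+ n.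
  by rewrite lerXn2r// nnegrE// (le_trans rmeps_ge0).
apply: (@le_trans _ _ (C * (r ^+ m * (kappa / rho)) ^+ n * rho ^+ n)).
  apply: ler_pM => //; last exact: ler_wpM2l.
  - by rewrite mulr_ge0// exprn_ge0.
  - by rewrite exprn_ge0.
rewrite -mulrA -exprMn -mulrA divfK ?gt_eqF//.
have -> : C * (r ^+ m * kappa) ^+ n =
    (r ^+ m * lambda) ^+ n * (C * (kappa / lambda) ^+ n).
  rewrite [RHS]mulrCA -exprMn; congr (_ * _ ^+ _).
  by rewrite -mulrA [lambda * _]mulrC divfK// gt_eqF.
rewrite ler_piMr ?hn2 ?(ltnW lt2)// exprn_ge0// mulr_ge0//.
exact: ltW.
Qed.

(** * Measures on the shift space *)

(** The mean of the number of events among the first [n] is at least [n * delta], so this number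
    reaches half of that with probability at least [delta / 2]. By continuity of the measure, this
    happens for infinitely many [n] with at least the same probability. *)
Lemma frequent_events (d : measure_display) (T : measurableType d) (R : realType)
    (P : probability T R) (A : nat -> set T) (delta : R) :
  0 < delta -> (forall j, measurable (A j)) -> (forall j, (delta%:E <= P (A j))%E) ->
  ~ {ae P, forall x, exists n0, forall n, (n0 <= n)%N ->
       \sum_(j <- iota 0 n) \1_(A j) x < delta / 2 * n%:R :> R}.
Proof.
move=> delta_gt0 mA PA.
pose f n x : R := \sum_(j <- iota 0 n) \1_(A j) x.
have mf n : measurable_fun [set: T] (f n).
  by apply: measurable_sum => j; exact: measurable_indic.
pose E n := [set x | delta / 2 * n%:R <= f n x].
have mE n : measurable (E n).
  rewrite (_ : E n = [set: T] `&` f n @^-1` `[delta / 2 * n%:R, +oo[%classic).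
    exact: mf.
  by rewrite setTI; apply/seteqP; split=> x /=; rewrite in_itv/= andbT.
have PE n : (0 < n)%N -> ((delta / 2)%:E <= P (E n))%E.
  move=> n_gt0.
  have lowerf : ((n%:R * delta)%:E <= \int[P]_x (f n x)%:E)%E.
    under eq_integral do rewrite -sumEFin.
    have mfj j : measurable_fun [set: T] (EFin \o (\1_(A j) : T -> R)).
      by apply/measurable_EFinP; exact: measurable_indic.
    have fj0 j x : [set: T] x -> (0 <= (\1_(A j) x : R)%:E)%E.
      by rewrite lee_fin.
    rewrite (ge0_integral_sum P measurableT mfj fj0).
    apply: (@le_trans _ _ (\sum_(j <- iota 0 n) delta%:E)%E).
      by rewrite sumEFin lee_fin big_const_seq count_predT size_iota iter_addr addr0 mulr_natl.
    by apply: lee_sum => j _; rewrite /= integral_indic// setIT; exact: PA.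
  (* Pointwise, [f n] is at most [n] on [E n] and at most [delta / 2 * n] off it. *)
  have upperf : (\int[P]_x (f n x)%:E <=
      \int[P]_x ((n%:R * \1_(E n) x)%:E + (delta / 2 * n%:R)%:E))%E.
    have f_ge0 x : 0 <= f n x by apply: sumr_ge0.
    apply: ge0_le_integral => //.
    - by move=> x _; rewrite lee_fin.
    - by apply/measurable_EFinP.
    - apply: emeasurable_funD => //; apply/measurable_EFinP.
      by apply: measurable_funM => //; exact: measurable_indic.
    move=> x _; rewrite -EFinD lee_fin indicE.
    have [xE|xE] := boolP (x \in E n).
      rewrite mulr1 (@le_trans _ _ n%:R)//; last first.
        by rewrite lerDl mulr_ge0// divr_ge0// ltW.
      apply: (@le_trans _ _ (\sum_(j <- iota 0 n) 1)).
        by apply: ler_sum => j _; rewrite indicE; case: (_ \in _); rewrite ?ler01.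
      by rewrite big_const_seq count_predT size_iota iter_addr addr0.
    rewrite mulr0 add0r ltW// ltNge; apply: contra xE => xE.
    by rewrite inE.
  have := le_trans lowerf upperf.
  have mE1 : measurable_fun [set: T] (EFin \o (\1_(E n) : T -> R)).
    by apply/measurable_EFinP; exact: measurable_indic.
  have mnE : measurable_fun [set: T] (fun x => (n%:R * \1_(E n) x : R)%:E).
    by apply/measurable_EFinP; apply: measurable_funM => //; exact: measurable_indic.
  rewrite (ge0_integralD P measurableT _ mnE)//; last first.
    by move=> x _; rewrite lee_fin mulr_ge0// divr_ge0// ltW.
  under eq_integral do rewrite EFinM.
  rewrite (ge0_integralZl_EFin P measurableT _ mE1)//; last by move=> x _; rewrite lee_fin.
  rewrite /= integral_indic// setIT integral_cst//.
  rewrite [X in (_ + _ * X)%E](_ : _ = 1%E) ?mule1; last exact: probability_setT.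
  have [p Pp] : exists p, P (E n) = p%:E.
    by exists (fine (P (E n))); rewrite fineK//; exact: fin_num_measure.
  move=> le; rewrite Pp lee_fin.
  have {}le : ((n%:R * delta)%:E <= n%:R%:E * p%:E + (delta / 2 * n%:R)%:E)%E.
    by rewrite -Pp; exact: le.
  move: le; rewrite -EFinM -EFinD lee_fin => le.
  have n0 : 0 < n%:R :> R by rewrite ltr0n.
  rewrite -(ler_pM2l n0); lra.
move=> [B [mB PB0 subB]].
(* Reverse Fatou: the measures of the decreasing tail unions, each containing some [E n], converge
   to the measure of the limit superior. *)
have cvgE := @lim_sup_set_cvg _ _ _ P E mE.
have {}cvgE := cvgE (le_lt_trans (probability_le1 P (bigcup_measurable (fun k _ => mE k))) (ltry 1)).
have : ((delta / 2)%:E <= P (lim_sup_set E))%E.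
  rewrite -(cvg_lim _ cvgE)//; apply: lime_ge; first by apply/cvg_ex; exists (P (lim_sup_set E)).
  near=> n; apply: le_trans (PE n _) _; first by near: n; exact: nbhs_infty_gt.
  apply: le_measure; rewrite ?inE//.
    by apply: bigcup_measurable.
  by move=> x Ex; exists n => /=.
have : (P (lim_sup_set E) <= P B)%E.
  apply: le_measure; rewrite ?inE//.
    by apply: bigcap_measurable => // n _; apply: bigcup_measurable.
  move=> x limx; apply: subB => /= -[n0 hn0].
  have [n /= /hn0] := limx n0 I; rewrite ltNge => /negP.
  by [].
rewrite PB0 => /[swap] /le_trans /[apply]; rewrite lee_fin leNgt.
by rewrite divr_gt0.
Unshelve. all: by end_near. Qed.

Lemma open_coordinate (K n : nat) (a : 'I_K) :
  open [set x : shift_space K | x n = a].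
Proof.
have := @open_comp (shift_space K) (discrete_topology 'I_K) (proj n) [set a : discrete_topology 'I_K].
apply; last exact: discrete_open.
by move=> x _; apply: (@proj_continuous nat (fun=> discrete_topology 'I_K) n).
Qed.

Lemma open_cylinder (K l m : nat) (w : seq 'I_K) :
  open [set x : shift_space K | mkseq (fun k => x (l + k)%N) m = w].
Proof.
elim: m w => [|m IHm] w.
  case: w => [|a w].
    rewrite (_ : [set _ | _] = setT); first exact: openT.
    by apply/seteqP; split.
  rewrite (_ : [set _ | _] = set0); first exact: open0.
  by apply/seteqP; split.
case/lastP: w => [|w a].
  rewrite (_ : [set _ | _] = set0); first exact: open0.
  by apply/seteqP; split=> // x /=.
rewrite (_ : [set _ | _] =
  [set x : shift_space K | mkseq (fun k => x (l + k)%N) m = w] `&`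
  [set x : shift_space K | x (l + m)%N = a]).
  by apply: openI; [exact: IHm | exact: open_coordinate].
apply/seteqP; split=> x /=; rewrite mkseqS.
  by move=> /eqP; rewrite eqseq_rcons => /andP[/eqP ? /eqP].
by case=> -> ->.
Qed.

Lemma measurable_cylinder (K l m : nat) (w : seq 'I_K.+1) :
  measurable [set x : borel_shift_space K.+1 | mkseq (fun k => x (l + k)%N) m = w].
Proof. by apply: sub_sigma_algebra; exact: open_cylinder. Qed.

Lemma invariant_cylinder (R : realType) (K l m : nat) (w : seq 'I_K.+1)
    (mu : probability (borel_shift_space K.+1) R) :
  ergodic mu ->
  mu [set x | mkseq (fun k => x (l + k)%N) m = w] =
  mu [set x | mkseq (fun k => x k) m = w].
Proof.
move=> [inv _]; elim: l => [|l <-]; first by [].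
by rewrite -[RHS]inv; [apply: congr1 | exact: measurable_cylinder].
Qed.

(** * From a periodic density point to the finiteness property *)

Lemma spectral_finiteness_word (R : realType) (d K : nat)
    (S : 'I_K -> 'M[R[i]]_d) (w : seq 'I_K) : (0 < size w)%N ->
  gen_spectral_radius S = spectral_radius (\prod_(i <- w) S i) `^ (size w)%:R^-1 ->
  spectral_finiteness S.
Proof.
move=> w_gt0 H; exists (size w), (in_tuple w); split; first exact: w_gt0.
rewrite H.
have e : \prod_(i <- w) S i = \prod_(k < size w) S (tnth (in_tuple w) k).
  exact: (big_tuple _ _ (in_tuple w)).
exact: (congr1 (fun A => spectral_radius A `^ (size w)%:R^-1) e).
Qed.

Lemma spectral_finiteness_of_extremal (R : realType) (d K : nat)
    (S : 'I_K.+1 -> 'M[R[i]]_d) (N : 'M[R[i]]_d -> R)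
    (mu : probability (borel_shift_space K.+1) R) (xi : shift_space K.+1) :
  (0 < d)%N -> submultiplicative_norm N -> ergodic mu -> extremal N S mu ->
  periodic_seq xi -> density_point mu xi -> spectral_finiteness S.
Proof.
move=> d_gt0 hN erg ext [p p_gt0 xip] dens; apply: contrapT => nofin.
pose r := gen_spectral_radius S.
have sr_ge0 (A : 'M[R[i]]_d) : 0 <= spectral_radius A.
  by have [a _ ->] := spectral_radius_attained A d_gt0; apply: normc_ge0.
pose w0 : seq 'I_K.+1 := mkseq xi p.
have w0_size : size w0 = p by rewrite size_mkseq.
have w0_gt0 : (0 < size w0)%N by rewrite w0_size.
have srr w : (0 < size w)%N -> spectral_radius (\prod_(i <- w) S i) `^ (size w)%:R^-1 <= r.
  by move=> w_gt0; exact: (spectral_radius_le_gen_spectral_radius S hN d_gt0 w_gt0).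
(* Equality would make [w0] a maximizing word. The strict inequality also yields [r > 0], which
   permits the rescaling by [r]. *)
have srw0 : spectral_radius (\prod_(i <- w0) S i) `^ (size w0)%:R^-1 < r.
  rewrite lt_neqAle (srr _ w0_gt0) andbT; apply/eqP => eqr; apply: nofin.
  by apply: (spectral_finiteness_word w0_gt0); rewrite eqr.
have r_gt0 : 0 < r by apply: le_lt_trans srw0; apply: powR_ge0.
have [|||q q_gt0 rare] := @rare_visits R d K.+1 S N r w0 (submultiplicative_norm_seminorm hN) r_gt0.
- exact: w0_gt0.
- move=> w a w_gt0 /eigenvalue_le_spectral_radius/le_trans; apply.
  exact: (powR_root_le (sr_ge0 _) w_gt0 (srr w w_gt0)).
- move=> a /eigenvalue_le_spectral_radius/le_lt_trans; apply.
  exact: (powR_root_lt (sr_ge0 _) w0_gt0 srw0).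
rewrite w0_size in rare.
pose m := (q * p)%N.
pose A j := [set x : borel_shift_space K.+1 |
  mkseq (fun k => x (j * m + k)%N) m = flatten (nseq q w0)].
(* The repeated period is a prefix of [xi], so its cylinder is an open neighborhood of the density
   point. *)
have xiE : mkseq xi m = flatten (nseq q w0).
  rewrite -flatten_blocks; congr flatten.
  have blockE j : block xi p j = w0.
    apply: eq_mkseq => k; elim: j => [//|j <-].
    by rewrite -(xip (j * p + k)%N) mulSn -addnA addnC.
  by rewrite (eq_map blockE) -{2}(size_iota 0 q); elim: (iota 0 q) => //= _ s ->.
pose D := mu [set x | mkseq (fun k => x k) m = flatten (nseq q w0)].
have D_gt0 : (0 < D)%E.
  by apply: dens => //; exact: (open_cylinder 0).
have [delta Ddelta] : exists delta, D = delta%:E.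
  exists (fine D); rewrite fineK//; apply: fin_num_measure.
  exact: (measurable_cylinder 0).
rewrite Ddelta lte_fin in D_gt0.
apply: (@frequent_events _ _ R mu A delta D_gt0).
- by move=> j; exact: measurable_cylinder.
- by move=> j; rewrite -Ddelta /A invariant_cylinder.
have delta2 : 0 < delta / 2 by rewrite divr_gt0.
(* Outside the null set of extremality the visits have frequency below [delta / 2], which
   [frequent_events] forbids. *)
have [B [mB B0 subB]] := ext; exists B; split; [exact: mB | exact: B0 |].
move=> x notQ; apply: subB => cvgx; apply: notQ.
have [n0 hn0] := rare _ delta2 x cvgx; exists n0 => n /hn0.
congr (_ < _); rewrite -sum1_count big_mkcond/= big_map natr_sum.
apply: eq_bigr => j _; rewrite indicE /block.
by case: ifP => [/eqP e|/eqP e]; [rewrite mem_set | rewrite memNset].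
Qed.

(** * Periodic orbits *)

Lemma ge_exp_root (R : realType) (x c : R) (n : nat) :
  0 <= c -> (0 < n)%N -> c ^+ n <= x -> c <= x `^ n%:R^-1.
Proof.
move=> c_ge0 n_gt0 le_x; have x_ge0 : 0 <= x by apply: le_trans le_x; apply: exprn_ge0.
have -> : c = (c ^+ n) `^ n%:R^-1.
  by have := @powR_exp_root R c n 1 c_ge0 n_gt0; rewrite muln1 invr1 powRr1// => ->.
by apply: ge0_ler_powR; rewrite ?nnegrE ?invr_ge0 ?exprn_ge0 ?ler0n.
Qed.

(** Multiplicative constants disappear under the roots. For [r = 0] nonnegativity of the roots
    replaces the lower bound. *)
Lemma cvg_root_exp_growth (R : realType) (u : nat -> R) (r : R) :
  0 <= r -> (forall m, 0 <= u m) ->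
  (forall r', r < r' -> exists C, forall m, u m <= C * r' ^+ m) ->
  (0 < r -> exists2 c, 0 < c & forall m, c * r ^+ m <= u m) ->
  u m `^ m%:R^-1 @[m --> \oo] --> r.
Proof.
move=> r_ge0 u_ge0 upper lower; apply/cvgrPdist_le => e e_gt0.
have [C hC] : exists C, forall m, u m <= C * (r + e / 2) ^+ m.
  by apply: upper; lra.
have [||n1 hn1] := @exp_lt_eventually R C ((r + e / 2) / (r + e)) 1.
- by apply/andP; split; [rewrite divr_ge0; lra | rewrite ltr_pdivrMr; lra].
- exact: ltr01.
have up m : (n1 <= m)%N -> (0 < m)%N -> u m `^ m%:R^-1 <= r + e.
  move=> /hn1 le1 m_gt0; apply: le_exp_root => //; first lra.
  apply: le_trans (hC m) _.
  have -> : C * (r + e / 2) ^+ m = (C * ((r + e / 2) / (r + e)) ^+ m) * (r + e) ^+ m.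
    by rewrite -mulrA -exprMn divfK// gt_eqF//; lra.
  by rewrite ler_piMl// exprn_ge0//; lra.
have [n2 low] : exists n2, forall m, (n2 <= m)%N -> (0 < m)%N -> r - e <= u m `^ m%:R^-1.
  have [re|re] := leP (r - e) 0.
    by exists 0%N => m _ _; apply: le_trans re (powR_ge0 _ _).
  have r_gt0 : 0 < r by lra.
  have [c c_gt0 hc] := lower r_gt0.
  have [||n2 hn2] := @exp_lt_eventually R c^-1 ((r - e) / r) 1.
  - by apply/andP; split; [rewrite divr_ge0; lra | rewrite ltr_pdivrMr; lra].
  - exact: ltr01.
  exists n2 => m /hn2 le1 m_gt0; apply: ge_exp_root => //; first exact: ltW.
  apply: le_trans (hc m).
  have -> : (r - e) ^+ m = (c^-1 * ((r - e) / r) ^+ m) * (c * r ^+ m).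
    rewrite mulrACA mulVf ?gt_eqF// mul1r -exprMn divfK//.
    by rewrite gt_eqF.
  by rewrite ler_piMl// mulr_ge0 ?exprn_ge0 ?ltW.
exists (maxn 1 (maxn n1 n2)) => // m /=.
rewrite !geq_max => /and3P[m_gt0 /up/(_ m_gt0) hu /low/(_ m_gt0) hl].
by rewrite ler_norml; apply/andP; split; lra.
Qed.

Section Growth.
Context (R : realType) (d K : nat) (S : 'I_K -> 'M[R[i]]_d).
Context (N : 'M[R[i]]_d -> R) (hN : submultiplicative_norm N).

Let hsN := submultiplicative_norm_seminorm hN.
Let N_ge0 A : 0 <= N A := seminorm_ge0 hsN A.
Let NM A B : N (A *m B) <= N A * N B.
Proof. by case: hN. Qed.

Let Pn (x : shift_space K) (m : nat) : 'M[R[i]]_d := \prod_(k < m) S (x k).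

Let PnS x m : Pn x m.+1 = S (x 0%N) *m Pn (left_shift x) m.
Proof. by rewrite /Pn big_ord_recl. Qed.

(** Prepending a letter multiplies the norm by at most a constant. Upper bounds therefore pass from
    the shifted sequence to the sequence, and lower bounds in the opposite direction. *)
Lemma upper_growth_unshift (x : shift_space K) (r : R) : 0 <= r ->
  (forall r', r < r' -> exists C, forall m, N (\prod_(k < m) S (left_shift x k)) <= C * r' ^+ m) ->
  (forall r', r < r' -> exists C, forall m, N (\prod_(k < m) S (x k)) <= C * r' ^+ m).
Proof.
move=> r_ge0 up r' ltr; have [C hC] := up r' ltr.
have r'_gt0 : 0 < r' by apply: le_lt_trans ltr.
exists (Num.max (N (Pn x 0)) (N (S (x 0%N)) * C / r')) => -[|m].
  by rewrite expr0 mulr1 le_max lexx.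
rewrite -/(Pn x m.+1) PnS; apply: le_trans (NM _ _) _.
apply: le_trans (ler_wpM2l (N_ge0 _) (hC m)) _.
have -> : N (S (x 0%N)) * (C * r' ^+ m) = N (S (x 0%N)) * C / r' * r' ^+ m.+1.
  by rewrite exprS [RHS]mulrA mulfVK ?gt_eqF// mulrA.
by rewrite ler_wpM2r ?exprn_ge0 ?(ltW r'_gt0)// le_max lexx orbT.
Qed.

Lemma lower_growth_shift (x : shift_space K) (r : R) : 0 < r ->
  (exists2 c, 0 < c & forall m, c * r ^+ m <= N (\prod_(k < m) S (x k))) ->
  (exists2 c, 0 < c & forall m, c * r ^+ m <= N (\prod_(k < m) S (left_shift x k))).
Proof.
move=> r_gt0 [c c_gt0 hc].
have n1 : 0 < N (S (x 0%N)) + 1 by rewrite ltr_wpDl.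
exists (c * r / (N (S (x 0%N)) + 1)) => [|m].
  by rewrite divr_gt0// mulr_gt0.
rewrite mulrAC ler_pdivrMr// -mulrA -exprS.
apply: le_trans (hc m.+1) _; rewrite -/(Pn x m.+1) PnS.
apply: le_trans (NM _ _) _; rewrite mulrC ler_wpM2l// lerDl//.
Qed.

Lemma upper_growth_iter (x : shift_space K) (r : R) (j : nat) : 0 <= r ->
  (forall r', r < r' -> exists C, forall m,
     N (\prod_(k < m) S (iter j (@left_shift K) x k)) <= C * r' ^+ m) ->
  (forall r', r < r' -> exists C, forall m, N (\prod_(k < m) S (x k)) <= C * r' ^+ m).
Proof.
move=> r_ge0; elim: j x => [//|j IHj] x up; apply: IHj.
by apply: upper_growth_unshift.
Qed.

Lemma lower_growth_iter (x : shift_space K) (r : R) (j : nat) : 0 < r ->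
  (exists2 c, 0 < c & forall m, c * r ^+ m <= N (\prod_(k < m) S (x k))) ->
  (exists2 c, 0 < c & forall m,
     c * r ^+ m <= N (\prod_(k < m) S (iter j (@left_shift K) x k))).
Proof.
by move=> r_gt0 low; elim: j => [//|j IHj]; apply: lower_growth_shift.
Qed.

End Growth.

Lemma iter_left_shiftE (K j k : nat) (x : shift_space K) :
  iter j (@left_shift K) x k = x (j + k)%N.
Proof. by elim: j k => [//|j IHj] k; rewrite iterS /left_shift IHj addSnnS. Qed.

Section PeriodicGrowth.
Context (R : realType) (d K : nat) (S : 'I_K -> 'M[R[i]]_d).
Context (N : 'M[R[i]]_d -> R) (hN : submultiplicative_norm N).
Context (xi : shift_space K) (n : nat) (n_gt0 : (0 < n)%N).
Hypothesis xi_periodic : forall k, xi (n + k)%N = xi k.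
Context (r : R) (r_ge0 : 0 <= r).

Let hsN := submultiplicative_norm_seminorm hN.
Let N_ge0 A : 0 <= N A := seminorm_ge0 hsN A.
Let NM A B : N (A *m B) <= N A * N B.
Proof. by case: hN. Qed.

Let Pn (m : nat) : 'M[R[i]]_d := \prod_(k < m) S (xi k).

Let xi_mul q k : xi (q * n + k)%N = xi k.
Proof. by elim: q => [//|q IHq]; rewrite mulSn -addnA xi_periodic. Qed.

Let Pn_mul q s : Pn (q * n + s) = Pn n ^+ q *m Pn s.
Proof.
rewrite /Pn big_split_ord/=; congr (_ *m _); last first.
  by apply: eq_bigr => k _; rewrite xi_mul.
elim: q => [|q IHq]; first by rewrite big_ord0.
rewrite mulSnr big_split_ord/= IHq exprSr; congr (_ * _).
by apply: eq_bigr => k _; rewrite xi_mul.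
Qed.

(** With [m = q * n + s] and [s < n], the product splits into the [q]-th power of the period product
    and one of finitely many remainders. *)
Lemma periodic_upper_growth :
  (forall a, eigenvalue (\prod_(k < n) S (xi k)) a -> Normc.normc a <= r ^+ n) ->
  forall r', r < r' -> exists C, forall m, N (\prod_(k < m) S (xi k)) <= C * r' ^+ m.
Proof.
move=> eigP r' ltr; have r'_gt0 : 0 < r' by apply: le_lt_trans ltr.
have [|C hC] := @seminorm_exp_le R d N hsN (Pn n) (r ^+ n) (r' ^+ n) _ eigP.
  by rewrite exprn_ge0//= ltrXn2r ?nnegrE ?(ltW r'_gt0)// -lt0n.
exists (C * \sum_(s < n) N (Pn s) / r' ^+ s) => m.
rewrite -/(Pn m) [in Pn m](divn_eq m n) Pn_mul; apply: le_trans (NM _ _) _.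
have lts : (m %% n < n)%N by rewrite ltn_mod.
have le_s : N (Pn (m %% n)) <= (\sum_(s < n) N (Pn s) / r' ^+ s) * r' ^+ (m %% n).
  rewrite -ler_pdivrMr ?exprn_gt0// (bigD1 (Ordinal lts))//= lerDl.
  by apply: sumr_ge0 => s _; rewrite divr_ge0// exprn_ge0// ltW.
apply: le_trans (ler_pM (N_ge0 _) (N_ge0 _) (hC _) le_s) _.
rewrite [in leRHS](divn_eq m n) exprD [(_ %/ _ * _)%N]mulnC exprM.
by rewrite le_eqVlt; apply/orP; left; apply/eqP; ring.
Qed.

(** Completing the first [m] letters to a multiple of the period gives a power of the period
    product, whose norm is at least the modulus of its eigenvalue; the added letters cost at most
    [D ^+ n]. *)
Lemma periodic_lower_growth (a : R[i]) :
  eigenvalue (\prod_(k < n) S (xi k)) a -> Normc.normc a = r ^+ n -> 0 < r ->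
  exists2 c, 0 < c & forall m, c * r ^+ m <= N (\prod_(k < m) S (xi k)).
Proof.
move=> Pa ar r_gt0; pose D := \big[Num.max/1]_i N (S i); pose b := Num.min 1 r.
have D_ge1 : 1 <= D by apply: bigmax_ge_id.
have b_gt0 : 0 < b by rewrite lt_min ltr01.
have b_le1 : b <= 1 by rewrite ge_min lexx.
have b_ler : b <= r by rewrite ge_min lexx orbT.
have D_gt0 : 0 < D by apply: lt_le_trans D_ge1.
exists (b ^+ n / D ^+ n) => [|m]; first by rewrite divr_gt0 ?exprn_gt0.
(* The completion always adds between 1 and [n] letters: the bound on norms of products is for
   nonempty words. Since [b <= 1 <= D], exponents [t] can be replaced by [n]. *)
pose t := (n - m %% n)%N; pose q := (m %/ n).+1.
have lts : (m %% n < n)%N by rewrite ltn_mod.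
have t_gt0 : (0 < t)%N by rewrite subn_gt0.
have le_tn : (t <= n)%N by apply: leq_subr.
have qnE : (q * n = m + t)%N.
  by rewrite /q mulSnr [in RHS](divn_eq m n) -addnA subnKC// ltnW.
have PqE : Pn n ^+ q = Pn m *m \prod_(i <- mkseq (fun k => xi (m + k)%N) t) S i.
  have := Pn_mul q 0; rewrite addn0 qnE /Pn big_split_ord/= big_ord0 mulmx1 => <-.
  by congr (_ *m _); rewrite prod_mkseq.
have le1 : r ^+ (m + t) <= N (Pn m) * D ^+ n.
  have -> : r ^+ (m + t) = Normc.normc (a ^+ q).
    by rewrite normcX ar -exprM -qnE mulnC.
  apply: le_trans (eigenvalue_le_norm hN (eigenvalue_exp q Pa)) _.
  rewrite -/(Pn n) PqE; apply: le_trans (NM _ _) _; rewrite ler_wpM2l//.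
  apply: (@le_trans _ _ (D ^+ t)); last by rewrite ler_weXn2l.
  have := @submultiplicative_norm_prod_le R d N hN D _ S
    (mkseq (fun k => xi (m + k)%N) t).
  rewrite size_mkseq; apply => //; first exact: ltW.
  by move=> i; apply: le_bigmax.
have le2 : b ^+ n <= r ^+ t.
  apply: (@le_trans _ _ (b ^+ t)); first by rewrite ler_wiXn2l// ltW.
  by rewrite lerXn2r ?nnegrE// ltW.
rewrite mulrAC ler_pdivrMr ?exprn_gt0//; apply: le_trans le1.
by rewrite exprD mulrC ler_wpM2l// exprn_ge0.
Qed.

End PeriodicGrowth.

(** Gelfand's formula along the orbit. The lower bound is carried from [xi] forward by [j] shifts;
    the upper bound is carried back from [xi], which is reached again after [n - j] more shifts. *)
Lemma periodic_orbit_cvg (R : realType) (d K : nat) (S : 'I_K -> 'M[R[i]]_d)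
    (N : 'M[R[i]]_d -> R) (xi : shift_space K) (n j : nat) :
  submultiplicative_norm N -> (0 < d)%N -> (0 < n)%N -> (j <= n)%N ->
  (forall k, xi (n + k)%N = xi k) ->
  N (\prod_(k < m) S (iter j (@left_shift K) xi k)) `^ m%:R^-1 @[m --> \oo] -->
    spectral_radius (\prod_(k < n) S (xi k)) `^ n%:R^-1.
Proof.
move=> hN d_gt0 n_gt0 le_jn xip.
have [a Pa aE] := spectral_radius_attained (\prod_(k < n) S (xi k)) d_gt0.
have Pmax b : eigenvalue (\prod_(k < n) S (xi k)) b -> Normc.normc b <= Normc.normc a.
  by rewrite -aE; exact: eigenvalue_le_spectral_radius.
rewrite aE; have r_ge0 := powR_ge0 (Normc.normc a) n%:R^-1.
have rn : Normc.normc a = (Normc.normc a `^ n%:R^-1) ^+ n.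
  rewrite -powR_mulrn// -powRrM mulVf ?powRr1 ?normc_ge0//.
  by rewrite pnatr_eq0 -lt0n.
move: (Normc.normc a `^ n%:R^-1) r_ge0 rn => r r_ge0 rn.
apply: cvg_root_exp_growth => //.
- by move=> m; apply: seminorm_ge0; exact: submultiplicative_norm_seminorm.
- apply: (@upper_growth_iter R d K S N hN _ r (n - j)) => //.
  have -> : iter (n - j) (@left_shift K) (iter j (@left_shift K) xi) = xi.
    by rewrite -iterD subnK//; apply/funext => k; rewrite iter_left_shiftE xip.
  by apply: (periodic_upper_growth hN n_gt0 xip r_ge0) => b /Pmax; rewrite -rn.
move=> r_gt0; apply: (lower_growth_iter hN j r_gt0).
exact: (periodic_lower_growth hN n_gt0 xip r_ge0 Pa rn r_gt0).
Qed.

(** * The uniform measure on a periodic orbit *)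

Lemma measurable_point (K : nat) (y : shift_space K.+1) :
  measurable ([set y] : set (borel_shift_space K.+1)).
Proof.
rewrite (_ : [set y] = \bigcap_m [set x : borel_shift_space K.+1 |
    mkseq (fun k => x (0 + k)%N) m = mkseq y m]).
  by apply: bigcap_measurable => [|m _]; [exists 0%N | exact: measurable_cylinder].
apply/seteqP; split=> [x -> //|x /= xy]; apply/funext => k.
have /(congr1 (nth ord0 ^~ k)) := xy k.+1 I.
by rewrite !nth_mkseq.
Qed.

Section OrbitMeasure.
Context (R : realType) (K : nat) (xi : shift_space K.+1) (n : nat).

Let orb (j : nat) : borel_shift_space K.+1 := iter j (@left_shift K.+1) xi.

(** The average of the Dirac masses at the first [n.+1] shifts of [xi]. The number [n.+1] may be any
    period, so points can be counted repeatedly. *)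
Definition orbit_measure : set (borel_shift_space K.+1) -> \bar R :=
  mscale (n.+1%:R^-1)%:nng (msum (fun j => \d_(orb j)) n.+1).

HB.instance Definition _ := Measure.on orbit_measure.

Lemma orbit_measureE A :
  orbit_measure A = (n.+1%:R^-1 * \sum_(j < n.+1) \1_A (orb j))%:E.
Proof. by rewrite /orbit_measure /mscale /msum/= EFinM -sumEFin. Qed.

Lemma orbit_measure_const A (b : bool) :
  (forall j, (j <= n)%N -> (orb j \in A) = b) -> orbit_measure A = b%:R%:E.
Proof.
move=> Ab; rewrite orbit_measureE (eq_bigr (fun=> b%:R)) => [|j _]; last first.
  by rewrite indicE Ab// -ltnS.
rewrite sumr_const card_ord; case: b {Ab}; last by rewrite mul0rn mulr0.
by rewrite mulVf// pnatr_eq0.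
Qed.

Lemma orbit_measure_setT : orbit_measure [set: _] = 1%E.
Proof. by rewrite (@orbit_measure_const _ true)// => j _; rewrite in_setT. Qed.

HB.instance Definition _ :=
  Measure_isProbability.Build _ _ _ orbit_measure orbit_measure_setT.

Definition orbit_probability : probability (borel_shift_space K.+1) R :=
  orbit_measure.

(** The shift permutes the Dirac masses cyclically, and an invariant set contains all the points of
    the orbit or none. *)
Lemma orbit_probability_ergodic :
  (forall k, xi (n.+1 + k)%N = xi k) -> ergodic orbit_probability.
Proof.
move=> xip; have orbn : orb n.+1 = orb 0.
  by apply/funext => k; rewrite /orb iter_left_shiftE xip.
split=> [A _|A _ invA].
  have indS j : \1_(@left_shift K.+1 @^-1` A) (orb j) = \1_A (orb j.+1) :> R.
    by rewrite !indicE; congr (_%:R); apply/idP/idP; rewrite !inE.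
  rewrite /orbit_probability/= !orbit_measureE; congr (_ * _)%:E.
  under eq_bigr do rewrite indS.
  rewrite big_ord_recr [RHS]big_ord_recl addrC; congr (_ + _).
  exact: (congr1 (fun x => \1_A x) orbn).
have orbA j : (orb j \in A) = (orb 0 \in A).
  elim: j => [//|j <-]; rewrite -[in RHS]invA.
  by apply/idP/idP; rewrite !inE.
rewrite /orbit_probability/= (@orbit_measure_const A (orb 0 \in A)) => [|j _].
  by case: (_ \in _); [right | left].
exact: orbA.
Qed.

Lemma orbit_probability_density : density_point orbit_probability xi.
Proof.
move=> U _ Uxi; rewrite /orbit_probability/= orbit_measureE lte_fin.
rewrite mulr_gt0 ?invr_gt0 ?ltr0n// big_ord_recl ltr_pwDl ?sumr_ge0//.
by rewrite indicE mem_set.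
Qed.

Lemma orbit_probability_ae (Q : shift_space K.+1 -> Prop) :
  (forall j, (j <= n)%N -> Q (orb j)) -> {ae orbit_probability, forall x, Q x}.
Proof.
move=> Qorb; pose O := \bigcup_(j in [set j | (j <= n)%N]) [set orb j].
exists (~` O); split.
- apply: measurableC; apply: bigcup_measurable => j _; exact: measurable_point.
- rewrite /orbit_probability/= (@orbit_measure_const _ false)// => j le_jn.
  by apply: memNset; apply; exists j.
- by move=> x /= notQ [j le_jn xE]; apply: notQ; rewrite xE; exact: Qorb.
Qed.

End OrbitMeasure.

(** * From a maximizing word to an extremal measure *)

Lemma extremal_of_spectral_finiteness (R : realType) (d K : nat)
    (S : 'I_K.+1 -> 'M[R[i]]_d) (N : 'M[R[i]]_d -> R) :
  (0 < d)%N -> submultiplicative_norm N -> spectral_finiteness S ->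
  exists mu : probability (borel_shift_space K.+1) R,
    [/\ ergodic mu, extremal N S mu &
        exists2 xi : shift_space K.+1, periodic_seq xi & density_point mu xi].
Proof.
move=> d_gt0 hN [[|n] [w [n_gt0 genE]]]; first by [].
pose xi : shift_space K.+1 := fun k => nth ord0 w (k %% n.+1).
have xip k : xi (n.+1 + k)%N = xi k by rewrite /xi modnDl.
exists (orbit_probability R xi n); split.
- exact: orbit_probability_ergodic.
- apply: orbit_probability_ae => j le_jn.
  have -> : gen_spectral_radius S =
      spectral_radius (\prod_(k < n.+1) S (xi k)) `^ n.+1%:R^-1.
    have -> : \prod_(k < n.+1) S (xi k) = \prod_(k < n.+1) S (tnth w k).
      by apply: eq_bigr => k _; rewrite /xi modn_small// (tnth_nth ord0).
    exact: genE.
  exact: (periodic_orbit_cvg hN d_gt0 n_gt0 (leqW le_jn) xip).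
- exists xi; last exact: orbit_probability_density.
  by exists n.+1 => // k; rewrite addnC xip.
Qed.

Theorem mainTheorem1 (R : realType) (d K : nat) (hd : (2 <= d)%N)
    (S : 'I_K.+2 -> 'M[R[i]]_d)
    (N : 'M[R[i]]_d -> R) (hN : submultiplicative_norm N) :
  spectral_finiteness S <->
  exists mu : probability (borel_shift_space K.+2) R,
    [/\ ergodic mu, extremal N S mu &
        exists2 xi : shift_space K.+2, periodic_seq xi & density_point mu xi].
Proof.
have d_gt0 : (0 < d)%N by apply: leq_trans hd.
split; first exact: extremal_of_spectral_finiteness d_gt0 hN.
move=> [mu [erg ext [xi xip dens]]].
exact: spectral_finiteness_of_extremal d_gt0 hN erg ext xip dens.
Qed.
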